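(* Let $\mathbf{I}=I_1\times\cdots\times I_d\subset\mathbb{R}^d$ be a closed and bounded product of intervals, let $\mu=\prod_{i=1}^d\mu_i$ be a finite product Borel measure on $\mathbf{I}$, and let $f\in L^2_\mu(\mathbf{I})$ be a Hölder continuous function with exponent $\alpha>1/2$ such that $f\in\mathcal{H}^k_\mu(\mathbf{I})$. Then the functional tensor-train decomposition $$f(\mathbf{x})=\sum_{\alpha_1,\ldots,\alpha_{d-1}=1}^\infty\gamma_1(\alpha_0;x_1;\alpha_1)\,\gamma_2(\alpha_1;x_2;\alpha_2)\cdots\gamma_d(\alpha_{d-1};x_d;\alpha_d),\qquad \alpha_0=\alpha_d=1,$$ is such that $\gamma_j(\alpha_{j-1};\cdot;\alpha_j)\in\mathcal{H}^k_{\mu_j}(I_j)$ for all $j$, $\alpha_{j-1}$ and $\alpha_j$.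
   Context: Sobolev spaces. For $k\ge 0$, $\mathcal{H}^k_\mu(\mathbf{I})$ is the space of $f\in L^2_\mu(\mathbf{I})$ with $\sum_{|\mathbf{i}|\le k}\|D^{(\mathbf{i})}f\|_{L^2_\mu(\mathbf{I})}<+\infty$, where $D^{(\mathbf{i})}f$ is the $\mathbf{i}$-th weak derivative of $f$, characterized by $(-1)^{|\mathbf{i}|}\int D^{(\mathbf{i})}f\,v\,d\mu=\int f\,v^{(\mathbf{i})}\,d\mu$ for all infinitely differentiable $v$ with compact support. The spaces $\mathcal{H}^k_{\mu_j}(I_j)$ are defined in the same way. Schmidt decomposition. Let $\mu=\mu_x\times\mu_y$ be a product measure on $X\times Y$ and $h\in L^2_\mu(X\times Y)$. Let $T:L^2_{\mu_y}(Y)\to L^2_{\mu_x}(X)$, $(Tg)(x)=\int_Y h(x,y)g(y)\,d\mu_y(y)$, with Hilbert adjoint $T^*$. The compact self-adjoint operators $TT^*$ and $T^*T$ have the same eigenvalues $\{\lambda(i)\}_{i=1}^\infty$, with associated eigenfunctions $\{\gamma(\cdot;i)\}_{i=1}^\infty\subset L^2_{\mu_x}(X)$ (for $TT^*$, forming an orthonormal basis) and $\{\varphi(i;\cdot)\}_{i=1}^\infty\subset L^2_{\mu_y}(Y)$ (for $T^*T$, orthonormal). The Schmidt decomposition of $h$ is $h=\sum_{i=1}^\infty\sqrt{\lambda(i)}\,\gamma(\cdot;i)\otimes\varphi(i;\cdot)$, with convergence in $L^2_\mu$. Functional tensor-train (FTT) decomposition. Given $f\in L^2_\mu(\mathbf{I})$,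 apply the Schmidt decomposition with $X=I_1$, $Y=I_2\times\cdots\times I_d$ to get $f=\sum_{\alpha_1=1}^\infty\sqrt{\lambda_1(\alpha_1)}\,\gamma_1(x_1;\alpha_1)\,\varphi_1(\alpha_1;x_2,\ldots,x_d)$. Recursively, for $i=2,\ldots,d-1$, apply the Schmidt decomposition to the kernel $(\alpha_{i-1},x_i,\ldots,x_d)\mapsto\sqrt{\lambda_{i-1}(\alpha_{i-1})}\,\varphi_{i-1}(\alpha_{i-1};x_i,\ldots,x_d)$ with $X=\mathbb{N}\times I_i$ (counting measure times $\mu_i$) and $Y=I_{i+1}\times\cdots\times I_d$: $$\sqrt{\lambda_{i-1}(\alpha_{i-1})}\,\varphi_{i-1}(\alpha_{i-1};x_i,\ldots,x_d)=\sum_{\alpha_i=1}^\infty\sqrt{\lambda_i(\alpha_i)}\,\gamma_i(\alpha_{i-1};x_i;\alpha_i)\,\varphi_i(\alpha_i;x_{i+1},\ldots,x_d).$$ With $\alpha_0=\alpha_d=1$, $\gamma_1(\alpha_0;x_1;\alpha_1)=\gamma_1(x_1;\alpha_1)$ and $\gamma_d(\alpha_{d-1};x_d;\alpha_d):=\sqrt{\lambda_{d-1}(\alpha_{d-1})}\,\varphi_{d-1}(\alpha_{d-1};x_d)$, substituting these expansions into one another yields the FTT decomposition. The functions $\gamma_1,\ldots,\gamma_d$ are its cores.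
   Formalization: For j<d the claim that the core γ_j(α_{j-1};·;α_j) lies in H^k is made only when λ_j(α_j)≠0; cores with zero eigenvalue are arbitrary kernel eigenfunctions (e.g. Haar functions for f=1), for which the claim fails. *)

(* Defs.v *)
From HB Require Import structures.
From mathcomp Require Import all_boot all_order all_algebra.
From mathcomp Require Import all_classical all_reals all_analysis.

Set Implicit Arguments.
Unset Strict Implicit.
Unset Printing Implicit Defensive.

Import Order.TTheory GRing.Theory Num.Theory.
Import numFieldNormedType.Exports.

Local Open Scope classical_set_scope.
Local Open Scope ring_scope.

Definition tuple_cons (T : Type) (n : nat) (z : T * n.-tuple T) :
    n.+1.-tuple T :=
  [tuple of z.1 :: z.2].

Lemma measurable_tuple_cons d (T : measurableType d) n :
  measurable_fun [set: T * n.-tuple T] (@tuple_cons T n).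
Proof. exact: measurable_cons. Qed.

Section cons_measure.
Context {R : realType} {n : nat}.
Context (m1 : {finite_measure set R -> \bar R}).
Context (m2 : {finite_measure set (n.-tuple R) -> \bar R}).

Definition cons_measure : set (n.+1.-tuple R) -> \bar R :=
  pushforward (m1 \x m2)%E (@tuple_cons R n).

Let mcons := @measurable_tuple_cons _ R n.

Let cons_measure0 : cons_measure set0 = 0%E.
Proof. exact: measure0. Qed.

Let cons_measure_ge0 A : (0 <= cons_measure A)%E.
Proof. exact: measure_ge0. Qed.

Let cons_measure_sigma_additive : semi_sigma_additive cons_measure.
Proof. exact: measure_semi_sigma_additive. Qed.

HB.instance Definition _ := isMeasure.Build _ _ _ cons_measure
  cons_measure0 cons_measure_ge0 cons_measure_sigma_additive.

Let cons_measure_fin : fin_num_fun cons_measure.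
Proof.
move=> A mA; rewrite ge0_fin_numE; last exact: measure_ge0.
apply: (@le_lt_trans _ _ (cons_measure setT)).
  by apply: le_measure; rewrite ?inE.
rewrite /cons_measure /pushforward preimage_setT -setXTT product_measure1E//.
apply: lte_mul_pinfty => //; last by rewrite ltey_eq fin_num_measure.
exact: fin_num_measure.
Qed.

HB.instance Definition _ :=
  Measure_isFinite.Build _ _ _ cons_measure cons_measure_fin.

End cons_measure.

Fixpoint box_measure (R : realType) (n : nat) :
    ('I_n -> {finite_measure set R -> \bar R}) ->
    {finite_measure set (n.-tuple R) -> \bar R} :=
  match n with
  | 0 => fun _ => \d_([tuple])
  | m.+1 => fun mu =>
      cons_measure (mu ord0) (box_measure (fun i => mu (lift ord0 i)))
  end.

Section hilbert_schmidt.
Context {R : realType} {d1 d2 : measure_display}.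
Context {X : measurableType d1} {Y : measurableType d2}.
Context (mx : {sigma_finite_measure set X -> \bar R}).
Context (my : {sigma_finite_measure set Y -> \bar R}).

Definition kernel_op (h : X * Y -> R) (g : Y -> R) : X -> R :=
  fun x => \int[my]_y (h (x, y) * g y).

Definition is_adjoint (T : (Y -> R) -> (X -> R)) (Ts : (X -> R) -> (Y -> R)) :=
  forall u, u \in Lfun mx 2%:E ->
    Ts u \in Lfun my 2%:E /\
    forall g, g \in Lfun my 2%:E ->
      \int[mx]_x (T g x * u x) = \int[my]_y (g y * Ts u y).

(* The indices i with lambda i = 0 are mere padding (the spectrum of TT* may be
   finite), so no condition beyond square integrability is imposed on the
   corresponding gamma i and phi i, which carry the weight sqrt 0 in the
   expansion of h. The convergence of the expansion expresses that the gamma i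
   and phi i with lambda i != 0 exhaust the nonzero spectrum, and pairs them. *)
Record schmidt (h : X * Y -> R) (lambda : nat -> R)
    (gamma : nat -> X -> R) (phi : nat -> Y -> R) : Prop := Schmidt {
  schmidt_ge0 : forall i, 0 <= lambda i ;
  schmidt_L2l : forall i, gamma i \in Lfun mx 2%:E ;
  schmidt_L2r : forall i, phi i \in Lfun my 2%:E ;
  schmidt_orthol : forall i j, lambda i != 0 -> lambda j != 0 ->
    \int[mx]_x (gamma i x * gamma j x) = (i == j)%:R ;
  schmidt_orthor : forall i j, lambda i != 0 -> lambda j != 0 ->
    \int[my]_y (phi i y * phi j y) = (i == j)%:R ;
  schmidt_eigen : exists2 Ts, is_adjoint (kernel_op h) Ts &
    forall i, lambda i != 0 ->
      (kernel_op h (Ts (gamma i)) = (fun x => lambda i * gamma i x) %[ae mx]) /\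
      (Ts (kernel_op h (phi i)) = (fun y => lambda i * phi i y) %[ae my]) ;
  schmidt_cvg :
    'N[(mx \x my)%E]_2%:E[EFin \o (fun z =>
       h z - \sum_(i < N) Num.sqrt (lambda i) * gamma i z.1 * phi i z.2)%R]%E
      @[N --> \oo] --> 0%E
}.

End hilbert_schmidt.

(* The library's sigma-finite instance on m1 \x m2 is shadowed by the one for
   subprobabilities, hence this named copy. *)
Section counting_product.
Context {R : realType} (m : {finite_measure set R -> \bar R}).

Definition counting_product : set (nat * R)%type -> \bar R :=
  (@counting nat R \x m)%E.

HB.instance Definition _ := Measure.on counting_product.

Let counting_product_sigma_finite : sigma_finite setT counting_product.
Proof.
exists (fun n => `I_n `*` [set: R]).
  by apply/seteqP; split=> // -[i x] _; exists i.+1; split=> //=.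
move=> n; split; first exact: measurableX.
have -> : counting_product (`I_n `*` [set: R]) =
    (@counting nat R `I_n * m setT)%E by exact: product_measure1E.
apply: lte_mul_pinfty => //; last by rewrite ltey_eq fin_num_measure.
by rewrite /counting asboolT//; exact: finite_II.
Qed.

HB.instance Definition _ := Measure_isSigmaFinite.Build _ _ _ counting_product
  counting_product_sigma_finite.

End counting_product.

Section tensor_train.
Context {R : realType}.

(* The part of the decomposition that starts from the kernel
   h (alpha_{j-1}, x_j, ..., x_d); lambda and gamma are indexed from j on. *)
Fixpoint ftt_from (n : nat) :
    ('I_n.+1 -> {finite_measure set R -> \bar R}) ->
    (nat -> n.+1.-tuple R -> R) ->
    ('I_n -> nat -> R) -> ('I_n.+1 -> nat -> R -> nat -> R) -> Prop :=
  match n with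
  | 0 => fun mu h lambda gamma =>
      forall a x, gamma ord0 a x 0%N = h a [tuple x]
  | m.+1 => fun mu h lambda gamma =>
      exists2 phi : nat -> m.+1.-tuple R -> R,
        schmidt (counting_product (mu ord0))
          (box_measure (fun i => mu (lift ord0 i)))
          (fun z => h z.1.1 (tuple_cons (z.1.2, z.2)))
          (lambda ord0) (fun b p => gamma ord0 p.1 p.2 b) phi &
        ftt_from (fun i => mu (lift ord0 i))
          (fun b y => Num.sqrt (lambda ord0 b) * phi b y)
          (fun i => lambda (lift ord0 i)) (fun i => gamma (lift ord0 i))
  end.

(* In gamma i a x b, a stands for alpha_{i-1} and b for alpha_i; indices start
   at 0, so alpha_0 = alpha_d = 1 reads a = 0 for the first core and b = 0 for
   the last one, whose other components are meaningless. *)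
Definition is_ftt (n : nat) (mu : 'I_n.+2 -> {finite_measure set R -> \bar R})
    (f : n.+2.-tuple R -> R) (lambda : 'I_n.+1 -> nat -> R)
    (gamma : 'I_n.+2 -> nat -> R -> nat -> R) : Prop :=
  exists2 phi : nat -> n.+1.-tuple R -> R,
    schmidt (mu ord0) (box_measure (fun i => mu (lift ord0 i)))
      (fun z => f (tuple_cons z))
      (lambda ord0) (fun b x => gamma ord0 0%N x b) phi &
    ftt_from (fun i => mu (lift ord0 i))
      (fun b y => Num.sqrt (lambda ord0 b) * phi b y)
      (fun i => lambda (lift ord0 i)) (fun i => gamma (lift ord0 i)).

(* alpha_i for 0 <= i <= d = m + 1, with both end indices equal to 0 *)
Definition ftt_index (m N : nat) (s : {ffun 'I_m -> 'I_N}) (i : nat) : nat :=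
  if i is i'.+1 then
    if insub i' is Some l then nat_of_ord (s l) else 0%N
  else 0%N.

Definition ftt_sum (n N : nat) (gamma : 'I_n.+2 -> nat -> R -> nat -> R)
    (x : n.+2.-tuple R) : R :=
  \sum_(s : {ffun 'I_n.+1 -> 'I_N}) \prod_(j < n.+2)
    gamma j (ftt_index s j) (tnth x j) (ftt_index s j.+1).

End tensor_train.

Section sobolev.
Context {R : realType} {n : nat}.

Definition row_of (x : n.-tuple R) : 'rV[R]_n := \row_i tnth x i.

Definition partial (j : 'I_n) (v : 'rV[R]_n -> R) : 'rV[R]_n -> R :=
  fun x => 'D_(delta_mx 0 j) v x.

Definition smooth (v : 'rV[R]_n -> R) : Prop :=
  forall (s : seq 'I_n) x, differentiable (foldr partial v s) x.

Definition multi_partial (k : 'I_n -> nat) (v : 'rV[R]_n -> R) :=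
  foldr (fun j => iter (k j) (partial j)) v (enum 'I_n).

(* U gives the open set carrying the test functions. The usual choice for a box
   is U j = interior of its j-th side; U j = setT puts no constraint on the
   support other than compactness. *)
Definition test_function (U : 'I_n -> set R) (v : 'rV[R]_n -> R) : Prop :=
  let supp := closure [set x | v x != 0] in
  [/\ smooth v, compact supp & supp `<=` [set x | forall j, U j (x 0 j)]].

Definition weak_derivative (U : 'I_n -> set R)
    (mu : 'I_n -> {finite_measure set R -> \bar R}) (k : 'I_n -> nat)
    (f Df : n.-tuple R -> R) : Prop :=
  forall v, test_function U v ->
    (-1) ^+ (\sum_j k j)%N * \int[box_measure mu]_x (Df x * v (row_of x)) =
    \int[box_measure mu]_x (f x * multi_partial k v (row_of x)).

(* The multi-indices of order at most k are the i : {ffun 'I_n -> 'I_k.+1} with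
   \sum_j i j <= k. *)
Definition sobolev (U : 'I_n -> set R)
    (mu : 'I_n -> {finite_measure set R -> \bar R}) (k : nat)
    (f : n.-tuple R -> R) : Prop :=
  f \in Lfun (box_measure mu) 2%:E /\
  exists D : {ffun 'I_n -> 'I_k.+1} -> n.-tuple R -> R,
    (forall i : {ffun 'I_n -> 'I_k.+1}, (\sum_j i j <= k)%N ->
       measurable_fun setT (D i) /\ weak_derivative U mu (fun j => i j) f (D i)) /\
    (\sum_(i : {ffun 'I_n -> 'I_k.+1} | (\sum_j i j <= k)%N)
       'N[box_measure mu]_2%:E[EFin \o D i] < +oo)%E.

Definition holder_on (A : set (n.-tuple R)) (alpha : R) (f : n.-tuple R -> R) :=
  exists C : R, forall x y, A x -> A y ->
    `|f x - f y| <= C * `|row_of x - row_of y| `^ alpha.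

End sobolev.

(* Main.v *)
Require Import Defs.
From HB Require Import structures.
From mathcomp Require Import all_boot all_order all_algebra.
From mathcomp Require Import all_classical all_reals all_analysis.
From mathcomp Require Import measurable_realfun.
From mathcomp Require Import ring lra.

Import Order.TTheory GRing.Theory Num.Theory.
Import numFieldNormedType.Exports.

Local Open Scope classical_set_scope.
Local Open Scope ring_scope.

(* Convergence. The left singular functions of each Schmidt decomposition are
   orthonormal, so by Pythagoras (for almost every value of the remaining
   variables) replacing the right singular functions by approximations costs at
   most the total squared error of these approximations; hence the errors of
   the successive truncations simply add up. The components with zero
   singular value drop out, since the cores fed by a vanishing row vanish
   almost everywhere.

   Regularity. A singular function with nonzero singular value is the integral
   of the kernel against its dual singular function, and differentiation in
   x_j commutes with integration against square integrable functions of the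
   other variables. The latter needs more than the smooth test functions of the
   definition of the weak derivative of f; it follows because products of
   one-variable bumps approximate the indicators of open boxes, which generate
   the sigma-algebra. Only the pure derivatives of f in the direction x_j
   matter for the j-th core, and Bessel's inequality keeps the derivative of
   the next kernel square integrable. *)

(** * Square integrable functions *)

(** Two choices shape the induction along the train. Both convergence and regularity pass from a
    kernel to the next one, whose rows are weighted by [Num.sqrt (lambda b)]. The statements are
    therefore about whole families of rows, with the errors or the derivatives square summable over
    the row index, since this is what a kernel for the counting measure requires. Each order of
    differentiation r is treated separately: a pair [(u, u')], made of a test function (up to sign)
    and its r-th derivative, is fixed once and for all and handed down unchanged to the j-th core.
    Hence no derivative of a core is ever differentiated again, and the induction asks of the pairs
    only that they be measurable and bounded; smoothness is used beforehand, to derive [weak_pair]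
    from [weak_derivative]. *)

Section L2.
Context {R : realType} {d : measure_display} {T : measurableType d}.
Variable mu : {measure set T -> \bar R}.
Implicit Types f g : T -> R.

Lemma eq_RintegralT g f : f =1 g -> \int[mu]_x f x = \int[mu]_x g x.
Proof. by move=> fg; apply: eq_Rintegral => x _. Qed.

Lemma Rintegral_sum I (s : seq I) (P : pred I) (F : I -> T -> R) :
  (forall i, P i -> mu.-integrable setT (EFin \o F i)) ->
  \int[mu]_x (\sum_(i <- s | P i) F i x) = \sum_(i <- s | P i) \int[mu]_x F i x.
Proof.
move=> hF; elim: s => [|i s ih].
  by under eq_Rintegral do rewrite big_nil; rewrite big_nil Rintegral_cst// mul0r.
rewrite big_cons; case: ifPn => Pi; last first.
  by under eq_Rintegral do rewrite big_cons (negbTE Pi).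
under eq_Rintegral do rewrite big_cons Pi.
rewrite RintegralD// ?ih//; first exact: hF.
rewrite (_ : _ \o _ = (fun x => \sum_(i <- s | P i) (F i x)%:E)%E);
  last by apply/funext => x /=; rewrite sumEFin.
by apply: integrable_sum => // j Pj; exact: hF.
Qed.

(** Stated through the integral of the square, to which Tonelli's theorem applies directly; [Lfun2P]
    relates it to [Lfun mu 2%:E]. *)
Definition L2 f := measurable_fun setT f /\ (\int[mu]_x (f x ^+ 2)%:E < +oo)%E.

Lemma Lnorm2_sqr f :
  ('N[mu]_2%:E[EFin \o f] `^ 2 = \int[mu]_x (f x ^+ 2)%:E)%E.
Proof.
rewrite poweR_Lnorm//; apply: eq_integral => x _ /=.
by rewrite powR_mulrn// real_normK// num_real.
Qed.

Lemma Lnorm2_lty f :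
  ('N[mu]_2%:E[EFin \o f] < +oo)%E <-> (\int[mu]_x (f x ^+ 2)%:E < +oo)%E.
Proof.
rewrite -Lnorm2_sqr; split=> [h|/lty_poweRy -> //]; exact: poweR_lty.
Qed.

Lemma Lfun2P f : f \in Lfun mu 2%:E <-> L2 f.
Proof.
split=> [/andP[/[!inE]/= mf]|[mf hf]].
  by rewrite /finite_norm => /Lnorm2_lty.
by apply/andP; split; rewrite inE//=; apply/Lnorm2_lty.
Qed.

Lemma L2_measurable {f} : L2 f -> measurable_fun setT f. Proof. by case. Qed.

Lemma L2M f g : L2 f -> L2 g -> mu.-integrable setT (fun x => (f x * g x)%:E).
Proof.
move=> [mf hf] [mg hg].
have mf2 : measurable_fun setT (fun x => (f x ^+ 2)%:E : \bar R).
  by apply/measurable_EFinP; exact: measurable_funX.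
have mg2 : measurable_fun setT (fun x => (g x ^+ 2)%:E : \bar R).
  by apply/measurable_EFinP; exact: measurable_funX.
apply/integrableP; split; first by apply/measurable_EFinP; exact: measurable_funM.
apply: (@le_lt_trans _ _
  (\int[mu]_x ((f x ^+ 2)%:E + (g x ^+ 2)%:E))%E); last first.
  rewrite ge0_integralD//; last 2 first.
  - by move=> x _; rewrite lee_fin sqr_ge0.
  - by move=> x _; rewrite lee_fin sqr_ge0.
  by rewrite lte_add_pinfty.
apply: ge0_le_integral => //.
- apply/measurableT_comp => //.
  by apply/measurable_EFinP; exact: measurable_funM.
- exact: emeasurable_funD.
- move=> x _; rewrite -EFinD lee_fin ler_norml; apply/andP; split; nra.
Qed.

Arguments L2M {f g}.

Lemma L2_sqr_int f : L2 f -> mu.-integrable setT (fun x => (f x ^+ 2)%:E).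
Proof. by move=> hf; under eq_fun do rewrite expr2; exact: L2M. Qed.

Arguments L2_sqr_int {f}.

Lemma EFin_Rintegral f : mu.-integrable setT (EFin \o f) ->
  (\int[mu]_x f x)%:E = (\int[mu]_x (f x)%:E)%E.
Proof. by move=> hf; rewrite fineK// integrable_fin_num. Qed.

Lemma L2_sqrE f : L2 f ->
  (\int[mu]_x (f x ^+ 2))%:E = (\int[mu]_x (f x ^+ 2)%:E)%E.
Proof. by move=> hf; rewrite EFin_Rintegral//; exact: L2_sqr_int. Qed.

Lemma L20 : L2 (fun=> 0).
Proof.
split=> //; rewrite integral0_eq// => x _.
by rewrite expr0n.
Qed.

Lemma L2D f g : L2 f -> L2 g -> L2 (fun x => f x + g x).
Proof.
move=> hf hg; split; first by apply: measurable_funD; apply: L2_measurable.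
have i1 := L2_sqr_int hf; have i2 := L2_sqr_int hg.
have i3 := integrableZl measurableT 2 (L2M hf hg).
have i := integrableD measurableT (integrableD measurableT i1 i2) i3.
rewrite (eq_integral (fun x => ((f x ^+ 2)%:E + (g x ^+ 2)%:E + 2%:E * (f x * g x)%:E)%E)).
  exact: integrable_lty i.
move=> x _; rewrite -EFinM -!EFinD; congr EFin; ring.
Qed.

Arguments L2D {f g}.

Lemma L2Z (c : R) f : L2 f -> L2 (fun x => c * f x).
Proof.
move=> hf; split; first by apply: measurable_funM => //; apply: L2_measurable.
under eq_integral do rewrite exprMn EFinM.
exact: integrable_lty (integrableZl measurableT (c ^+ 2) (L2_sqr_int hf)).
Qed.

Arguments L2Z c {f}.

Lemma L2B f g : L2 f -> L2 g -> L2 (fun x => f x - g x).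
Proof.
move=> hf hg; have := L2D hf (L2Z (-1) hg).
by under [X in L2 X]eq_fun do rewrite mulN1r.
Qed.

Arguments L2B {f g}.

Lemma L2_sum I (s : seq I) (P : pred I) (F : I -> T -> R) :
  (forall i, P i -> L2 (F i)) -> L2 (fun x => \sum_(i <- s | P i) F i x).
Proof.
move=> hF; elim: s => [|i s ih].
  by under eq_fun do rewrite big_nil; exact: L20.
have [Pi|nPi] := boolP (P i); last first.
  by under eq_fun do rewrite big_cons (negbTE nPi).
under eq_fun do rewrite big_cons Pi.
by apply: L2D => //; exact: hF.
Qed.

Lemma measurable_sum_cond I (s : seq I) (P : pred I) (F : I -> T -> R) :
  (forall i, P i -> measurable_fun setT (F i)) ->
  measurable_fun setT (fun x => \sum_(i <- s | P i) F i x).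
Proof.
move=> hF; elim: s => [|i s ih].
  by under eq_fun do rewrite big_nil; exact: measurable_cst.
have [Pi|nPi] := boolP (P i); last first.
  by under eq_fun do rewrite big_cons (negbTE nPi).
under eq_fun do rewrite big_cons Pi.
by apply: measurable_funD => //; exact: hF.
Qed.

Lemma L2_le f g : measurable_fun setT f -> (forall x, `|f x| <= `|g x|) ->
  L2 g -> L2 f.
Proof.
move=> mf fg [mg hg]; split=> //; apply: le_lt_trans hg.
apply: ge0_le_integral => //.
- by move=> x _; rewrite lee_fin sqr_ge0.
- by apply/measurable_EFinP; exact: measurable_funX.
- by apply/measurable_EFinP; exact: measurable_funX.
by move=> x _; rewrite lee_fin -ler_sqrt ?sqr_ge0// !sqrtr_sqr.
Qed.

Lemma L2_bounded_mul f g (C : R) : measurable_fun setT f ->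
  (forall x, `|f x| <= C) -> L2 g -> L2 (fun x => f x * g x).
Proof.
move=> mf fC hg; apply: (L2_le _ (fun x => C * g x)).
- by apply: measurable_funM => //; exact: L2_measurable.
- move=> x; rewrite !normrM ler_wpM2r//.
  by rewrite (le_trans (fC x))// ler_norm.
- exact: L2Z.
Qed.

Lemma L2_mul_bounded g f (C : R) : measurable_fun setT f ->
  (forall x, `|f x| <= C) -> L2 g -> L2 (fun x => g x * f x).
Proof.
move=> mf fC hg; rewrite (_ : (fun x => _) = (fun x => f x * g x)).
  exact: (L2_bounded_mul _ _ C).
by apply/funext => x; rewrite mulrC.
Qed.

(** The coefficients are arbitrary, so that one identity gives both Bessel's inequality ([c] the
    Fourier coefficients of [g]) and Pythagoras for finite sums ([g] zero). Restricting to [P]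
    leaves room for the indices of zero singular value, where orthonormality is not known. *)
Lemma int_sqr_sub_sum (g : T -> R) (e : nat -> T -> R) (c : nat -> R)
    (P : pred nat) N :
  L2 g -> (forall i, P i -> L2 (e i)) ->
  (forall i j, P i -> P j -> \int[mu]_x (e i x * e j x) = (i == j)%:R) ->
  \int[mu]_x ((g x - \sum_(i < N | P i) c i * e i x) ^+ 2) =
  \int[mu]_x (g x ^+ 2) - 2 * (\sum_(i < N | P i) c i * \int[mu]_x (g x * e i x))
    + \sum_(i < N | P i) c i ^+ 2.
Proof.
move=> hg he ortho; elim: N => [|N ih].
  rewrite !big_ord0 mulr0 subr0 addr0; apply: eq_Rintegral => x _.
  by rewrite big_ord0 subr0.
under eq_Rintegral do rewrite big_mkcond big_ord_recr/= -big_mkcond/=.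
rewrite [in RHS]big_mkcond big_ord_recr/= -big_mkcond/=.
rewrite [X in _ = _ + X]big_mkcond big_ord_recr/= -big_mkcond/=.
case: ifPn => PN; last first.
  by under eq_Rintegral do rewrite addr0; rewrite !addr0.
have hs : L2 (fun x => \sum_(i < N | P i) c i * e i x).
  by apply: L2_sum => i Pi; exact/L2Z/he.
have hr := L2B hg hs.
have heN := L2Z (c N) (he N PN).
have i1 := L2_sqr_int hr; have i2 := L2_sqr_int heN.
have i3 := integrableZl measurableT 2 (L2M hr heN).
rewrite (eq_RintegralT (fun x => (g x - \sum_(i < N | P i) c i * e i x) ^+ 2
  - 2 * ((g x - \sum_(i < N | P i) c i * e i x) * (c N * e N x)) + (c N * e N x) ^+ 2));
  last by move=> x; ring.
rewrite RintegralD//; last exact: (integrableB measurableT i1 i3).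
rewrite RintegralB// ih RintegralZl//; last exact: L2M.
have -> : \int[mu]_x ((c N * e N x) ^+ 2) = c N ^+ 2.
  under eq_Rintegral do rewrite exprMn expr2.
  rewrite RintegralZl//.
    under eq_Rintegral do rewrite expr2.
    by rewrite ortho// eqxx mulr1 expr2.
  exact: L2_sqr_int (he N PN).
(* [e N] is orthogonal to the earlier terms, so the cross term sees only [g]. *)
have -> : \int[mu]_x ((g x - \sum_(i < N | P i) c i * e i x) * (c N * e N x))
    = c N * \int[mu]_x (g x * e N x).
  rewrite (eq_RintegralT (fun x => c N * (g x * e N x -
     (\sum_(i < N | P i) c i * e i x) * e N x))); last by move=> x; ring.
  rewrite RintegralZl//; last first.
    exact: (integrableB measurableT (L2M hg (he N PN)) (L2M hs (he N PN))).
  rewrite RintegralB//; [|by apply: L2M => //; exact: he..].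
  suff -> : \int[mu]_x ((\sum_(i < N | P i) c i * e i x) * e N x) = 0.
    by rewrite subr0.
  rewrite (_ : (fun x => _) = (fun x => \sum_(i < N | P i) (c i * (e i x * e N x))));
    last by apply/funext => x; rewrite mulr_suml; apply: eq_bigr => i _; rewrite mulrA.
  rewrite Rintegral_sum; last first.
    move=> i Pi.
    exact: (integrableZl measurableT (c i) (L2M (he i Pi) (he N PN))).
  apply: big1 => i Pi; rewrite RintegralZl//; last by apply: L2M => //; exact: he.
  by rewrite ortho// ltn_eqF ?ltn_ord// mulr0.
ring.
Qed.

Lemma int_sqr_sum (e : nat -> T -> R) (c : nat -> R) (P : pred nat) N :
  (forall i, P i -> L2 (e i)) ->
  (forall i j, P i -> P j -> \int[mu]_x (e i x * e j x) = (i == j)%:R) ->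
  (\int[mu]_x ((\sum_(i < N | P i) c i * e i x) ^+ 2)%:E =
   (\sum_(i < N | P i) c i ^+ 2)%:E)%E.
Proof.
move=> he ortho.
have := int_sqr_sub_sum _ _ c P N L20 he ortho.
under eq_Rintegral do rewrite sub0r sqrrN.
rewrite -L2_sqrE; last by apply: L2_sum => i Pi; exact/L2Z/he.
move=> ->.
under eq_Rintegral do rewrite expr0n/=.
rewrite Rintegral_cst// mul0r sub0r big1 ?mulr0 ?oppr0 ?add0r// => i _.
by under eq_Rintegral do rewrite mul0r; rewrite Rintegral_cst// mul0r mulr0.
Qed.

Lemma bessel (g : T -> R) (e : nat -> T -> R) (P : pred nat) N :
  L2 g -> (forall i, P i -> L2 (e i)) ->
  (forall i j, P i -> P j -> \int[mu]_x (e i x * e j x) = (i == j)%:R) ->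
  \sum_(i < N | P i) (\int[mu]_x (g x * e i x)) ^+ 2 <= \int[mu]_x (g x ^+ 2).
Proof.
move=> hg he ortho.
have := int_sqr_sub_sum _ _ (fun i => \int[mu]_x (g x * e i x)) P N hg he ortho.
move=> h; rewrite -subr_ge0; have : 0 <= \int[mu]_x (g x ^+ 2) -
    \sum_(i < N | P i) (\int[mu]_x (g x * e i x)) ^+ 2.
  apply: le_trans (_ : \int[mu]_x ((g x - \sum_(i < N | P i)
    (\int[mu]_z (g z * e i z)) * e i x) ^+ 2) <= _).
    by apply: Rintegral_ge0 => x _; rewrite sqr_ge0.
  by rewrite h; under [X in 2 * X]eq_bigr do rewrite -expr2; lra.
by [].
Qed.

Lemma bessel1 (g e : T -> R) : L2 g -> L2 e -> \int[mu]_x (e x * e x) = 1 ->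
  (\int[mu]_x (g x * e x)) ^+ 2 <= \int[mu]_x (g x ^+ 2).
Proof.
move=> hg he e1.
(* Cauchy-Schwarz against a unit vector is Bessel's inequality for a family with the single index
   0. *)
have := bessel _ (fun=> e) (pred1 0%N) 1 hg (fun _ _ => he).
rewrite big_mkcond big_ord1/=; apply=> i j /eqP-> /eqP->.
by rewrite e1.
Qed.

Lemma ge0_int_sqr_eq0 f : measurable_fun setT f ->
  (\int[mu]_x (f x ^+ 2)%:E = 0)%E -> ae_eq mu setT f (fun=> 0).
Proof.
move=> mf f0.
have /(ae_eq_integral_abs mu measurableT) [h _] :
    measurable_fun setT (fun x => (f x ^+ 2)%:E : \bar R).
  by apply/measurable_EFinP; exact: measurable_funX.
have /h : (\int[mu]_x `|(f x ^+ 2)%:E| = 0)%E.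
  rewrite -[RHS]f0; apply: eq_integral => x _.
  by rewrite abse_EFin ger0_norm// sqr_ge0.
by apply: filterS => x /(_ I) [] /eqP; rewrite sqrf_eq0 => /eqP fx _.
Qed.

End L2.
Arguments L2 {R d T} mu f.
Arguments eq_RintegralT {R d T mu} g {f}.
Arguments L2_measurable {R d T mu f}.
Arguments L2M {R d T mu f g}.
Arguments L2_sqr_int {R d T mu f}.
Arguments L2D {R d T mu f g}.
Arguments L2Z {R d T mu} c {f}.
Arguments L2B {R d T mu f g}.
Arguments L2_le {R d T mu f} g.
Arguments ge0_int_sqr_eq0 {R d T mu f}.

(** * Iterated integrals *)

Section cvg0.
Context {R : realType}.
Implicit Types u : nat -> \bar R.

(** An epsilon form that admits infinite terms below the rank, because the squared errors are not
    known to be finite a priori. *)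
Lemma cvge0P u : (forall N, (0 <= u N)%E) ->
  (u N @[N --> \oo] --> 0%E) <->
  (forall e : R, 0 < e -> exists N0, forall N, (N0 <= N)%N -> (u N <= e%:E)%E).
Proof.
move=> u0; split=> [/fine_cvgP[[N0 _ hfin] /cvgrPdist_le hu] e e0|h].
  have [N1 _ hN1] := hu _ e0.
  exists (maxn N0 N1) => N; rewrite geq_max => /andP[N0N N1N].
  have := hN1 N N1N; rewrite /= sub0r normrN ger0_norm ?fine_ge0//.
  by rewrite -lee_fin fineK//; exact: hfin.
apply/fine_cvgP; split.
  have [N0 hN0] := h 1 ltr01; exists N0 => // N /= N0N.
  by rewrite ge0_fin_numE// (le_lt_trans (hN0 N N0N))// ltry.
apply/cvgrPdist_le => e e0; have [N0 hN0] := h e e0; exists N0 => // N /= N0N.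
rewrite sub0r normrN ger0_norm ?fine_ge0//.
have := hN0 N N0N; have : u N \is a fin_num.
  by rewrite ge0_fin_numE// (le_lt_trans (hN0 N N0N))// ltry.
by move=> uN; rewrite -{1}(fineK uN) lee_fin.
Qed.

Lemma cvge0_sqr u : (forall N, (0 <= u N)%E) ->
  ((u N `^ 2)%E @[N --> \oo] --> 0%E) <-> (u N @[N --> \oo] --> 0%E).
Proof.
move=> u0; have p0 N : (0 <= u N `^ 2)%E by rewrite poweR_ge0.
rewrite (cvge0P _ p0) (cvge0P _ u0).
have itv (x : \bar R) : (0 <= x)%E -> x \in `[0%E, +oo%E].
  by move=> x0; rewrite in_itv/= x0 leey.
split=> h e e0.
  have [N0 hN0] := h (e ^+ 2) (exprn_gt0 2 e0); exists N0 => N /hN0 le2.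
  rewrite leNgt; apply/negP => elt; move: le2; apply/negP; rewrite -ltNge.
  case: (u N) (u0 N) elt => [r||]//= r0; last by rewrite pnatr_eq0/= !ltry.
  by rewrite !lte_fin powR_mulrn// ltr_pXn2r// nnegrE ltW.
have se0 : 0 < Num.sqrt e by rewrite sqrtr_gt0.
have [N0 hN0] := h _ se0; exists N0 => N /hN0 le2.
have -> : e%:E = ((Num.sqrt e)%:E `^ 2)%E.
  by rewrite /= powR_mulrn ?sqrtr_ge0// sqr_sqrtr// ltW.
by apply: gt0_ler_poweR => //; rewrite itv// lee_fin ltW.
Qed.

End cvg0.

Lemma Lnorm2_cvg0 {R : realType} d (T : measurableType d)
    (mu : {measure set T -> \bar R}) (f : nat -> T -> R) :
  ('N[mu]_2%:E[EFin \o f N]%E @[N --> \oo] --> 0%E) <->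
  ((\int[mu]_x (f N x ^+ 2)%:E)%E @[N --> \oo] --> 0%E).
Proof.
rewrite -cvge0_sqr; last by move=> N; exact: Lnorm_ge0.
by under [in X in X <-> _]eq_fun do rewrite Lnorm2_sqr.
Qed.

Section product.
Context {R : realType} {d1 d2 : measure_display}.
Context {X : measurableType d1} {Y : measurableType d2}.
Variable mx : {sigma_finite_measure set X -> \bar R}.
Variable my : {sigma_finite_measure set Y -> \bar R}.
Implicit Types (h : X * Y -> R).

Lemma measurable_slice1 h x : measurable_fun setT h ->
  measurable_fun setT (fun y => h (x, y)).
Proof. by move=> mh; exact: (measurableT_comp mh (pair1_measurable x)). Qed.

Lemma measurable_slice2 h y : measurable_fun setT h ->
  measurable_fun setT (fun x => h (x, y)).
Proof. by move=> mh; exact: (measurableT_comp mh (pair2_measurable y)). Qed.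

Lemma measurable_sqr {d} {T : measurableType d} (f : T -> R) :
  measurable_fun setT f ->
  measurable_fun setT (fun x => (f x ^+ 2)%:E : \bar R).
Proof. by move=> mf; apply/measurable_EFinP; exact: measurable_funX. Qed.

(** The real integral is [fine] of the difference of the integrals of the positive and negative
    parts, and both are measurable in x by Tonelli's theorem. *)
Lemma measurable_Rintegral1 h : measurable_fun setT h ->
  measurable_fun setT (fun x => \int[my]_y h (x, y)).
Proof.
move=> mh; apply: (measurableT_comp (fine_measurable measurableT)) => /=.
under eq_fun do rewrite integralE.
have mEh : measurable_fun setT (EFin \o h) by exact/measurable_EFinP.
apply: emeasurable_funB.
- have := @measurable_fun_fubini_tonelli_F _ _ X Y R my ((EFin \o h)^\+)%E.
  rewrite /fubini_F; under eq_fun do under eq_integral do rewrite funeposE.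
  under [in X in _ -> X]eq_fun do under eq_integral do rewrite funeposE/=.
  by apply=> //; exact: measurable_funepos.
- have := @measurable_fun_fubini_tonelli_F _ _ X Y R my ((EFin \o h)^\-)%E.
  rewrite /fubini_F; under eq_fun do under eq_integral do rewrite funenegE.
  under [in X in _ -> X]eq_fun do under eq_integral do rewrite funenegE/=.
  by apply=> //; exact: measurable_funeneg.
Qed.

Lemma integral_sqr_prod h : measurable_fun setT h ->
  (\int[(mx \x my)%E]_z (h z ^+ 2)%:E =
   \int[mx]_x \int[my]_y (h (x, y) ^+ 2)%:E)%E.
Proof.
move=> mh; rewrite fubini_tonelli1//; first exact: measurable_sqr.
by move=> z; rewrite lee_fin sqr_ge0.
Qed.

Lemma integral_sqr_swap h : measurable_fun setT h ->
  (\int[mx]_x \int[my]_y (h (x, y) ^+ 2)%:E =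
   \int[my]_y \int[mx]_x (h (x, y) ^+ 2)%:E)%E.
Proof.
move=> mh; rewrite (fubini_tonelli (fun z => (h z ^+ 2)%:E))//.
  exact: measurable_sqr.
by move=> z; rewrite lee_fin sqr_ge0.
Qed.

Lemma L2_prodP h : L2 (mx \x my)%E h <-> (measurable_fun setT h /\
  (\int[mx]_x \int[my]_y (h (x, y) ^+ 2)%:E < +oo)%E).
Proof.
by split=> [[mh]|[mh]]; [rewrite integral_sqr_prod|rewrite -integral_sqr_prod].
Qed.

Lemma integral_sqr_tensor (g : X -> R) (p : Y -> R) :
  measurable_fun setT g -> measurable_fun setT p ->
  (\int[mx]_x \int[my]_y ((g x * p y) ^+ 2)%:E =
   \int[mx]_x (g x ^+ 2)%:E * \int[my]_y (p y ^+ 2)%:E)%E.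
Proof.
move=> mg mp.
under eq_integral.
  move=> x _; under eq_integral do rewrite exprMn EFinM.
  rewrite ge0_integralZl//; last by rewrite lee_fin sqr_ge0.
  - over.
  - exact: measurable_sqr.
  - by move=> y _; rewrite lee_fin sqr_ge0.
rewrite ge0_integralZr//.
- exact: measurable_sqr.
- by move=> y _; rewrite lee_fin sqr_ge0.
- by apply: integral_ge0 => y _; rewrite lee_fin sqr_ge0.
Qed.

Lemma L2_tensor (g : X -> R) (p : Y -> R) : L2 mx g -> L2 my p ->
  L2 (mx \x my)%E (fun z => g z.1 * p z.2).
Proof.
move=> [mg hg] [mp hp]; apply/L2_prodP; split=> /=.
  apply: measurable_funM.
    exact: (measurableT_comp mg measurable_fst).
  exact: (measurableT_comp mp measurable_snd).
rewrite integral_sqr_tensor// lte_mul_pinfty//.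
- by apply: integral_ge0 => y _; rewrite lee_fin sqr_ge0.
- rewrite ge0_fin_numE//.
  by apply: integral_ge0 => y _; rewrite lee_fin sqr_ge0.
Qed.

(** An infinite right-hand side makes the inequality trivial, so it applies to every slice of a
    kernel and not only to almost every one. *)
Lemma Rintegral_sqr_le (g e : Y -> R) : measurable_fun setT g -> L2 my e ->
  \int[my]_y (e y * e y) = 1 ->
  (((\int[my]_y (g y * e y)) ^+ 2)%:E <= \int[my]_y (g y ^+ 2)%:E)%E.
Proof.
move=> mg he e1.
have [hg|] := ltP (\int[my]_y (g y ^+ 2)%:E)%E +oo%E; last first.
  by rewrite leye_eq => /eqP ->; exact: leey.
have hg2 : L2 my g by [].
by rewrite -L2_sqrE// lee_fin bessel1.
Qed.

Lemma L2_kernel h (e : Y -> R) : L2 (mx \x my)%E h -> L2 my e ->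
  \int[my]_y (e y * e y) = 1 -> L2 mx (fun x => \int[my]_y (h (x, y) * e y)).
Proof.
move=> /L2_prodP[mh hh] he e1.
have m : measurable_fun setT (fun x => \int[my]_y (h (x, y) * e y)).
  apply: (measurable_Rintegral1 (fun z => h z * e z.2)).
  apply: measurable_funM => //.
  by apply: (measurableT_comp (L2_measurable he) measurable_snd).
split=> //; apply: le_lt_trans hh; apply: ge0_le_integral => //.
- by move=> x _; rewrite lee_fin sqr_ge0.
- exact: measurable_sqr.
- apply: (measurable_fun_fubini_tonelli_F (fun z => (h z ^+ 2)%:E)).
    exact: measurable_sqr.
  by move=> z; rewrite lee_fin sqr_ge0.
- move=> x _; apply: Rintegral_sqr_le => //; exact: measurable_slice1.
Qed.

(** For b < N, the difference [k] of the two sides is, up to sign, the coefficient along [e b] of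
    the slice of the remainder [r N], so its square is at most the squared norm of that slice.
    Integrating over x bounds the integral of [k ^+ 2] by errors that tend to 0. The two families
    play asymmetric roles; exchanging the variables gives the relation for the other one. *)
Lemma singular_relation h (s : nat -> R) (g : nat -> X -> R) (e : nat -> Y -> R) :
  measurable_fun setT h ->
  (forall i, s i != 0 -> L2 mx (g i)) -> (forall i, s i != 0 -> L2 my (e i)) ->
  (forall i j, s i != 0 -> s j != 0 ->
    \int[my]_y (e i y * e j y) = (i == j)%:R) ->
  (\int[mx]_x \int[my]_y ((h (x, y) -
      \sum_(i < N | s i != 0) s i * g i x * e i y) ^+ 2)%:E)%E
    @[N --> \oo] --> 0%E ->
  forall b, s b != 0 ->
  ae_eq mx setT (fun x => s b * g b x) (fun x => \int[my]_y (h (x, y) * e b y)).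
Proof.
move=> mh hg he ortho hcvg b sb.
pose k x := s b * g b x - \int[my]_y (h (x, y) * e b y).
pose r N z := h z - \sum_(i < N | s i != 0) s i * g i z.1 * e i z.2.
have mr N : measurable_fun setT (r N).
  apply: measurable_funB => //.
  apply: measurable_sum_cond => i si.
  apply: measurable_funM; last first.
    by apply: (measurableT_comp (L2_measurable (he i si)) measurable_snd).
  apply: measurable_funM => //.
  by apply: (measurableT_comp (L2_measurable (hg i si)) measurable_fst).
have mk : measurable_fun setT k.
  apply: measurable_funB.
    by apply: measurable_funM => //; exact: (L2_measurable (hg b sb)).
  apply: (measurable_Rintegral1 (fun z => h z * e b z.2)).
  apply: measurable_funM => //.
  by apply: (measurableT_comp (L2_measurable (he b sb)) measurable_snd).
have kr N x : (b < N)%N ->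
    ((k x ^+ 2)%:E <= \int[my]_y (r N (x, y) ^+ 2)%:E)%E.
  move=> bN.
  have [hr|] := ltP (\int[my]_y (r N (x, y) ^+ 2)%:E)%E +oo%E; last first.
    by rewrite leye_eq => /eqP ->; exact: leey.
  have lr : L2 my (fun y => r N (x, y)).
    by split=> //; exact: measurable_slice1.
  have ls : L2 my (fun y => \sum_(i < N | s i != 0) s i * g i x * e i y).
    by apply: L2_sum => i si; apply: L2Z; exact: he.
  suff -> : k x ^+ 2 = (\int[my]_y (r N (x, y) * e b y)) ^+ 2.
    apply: Rintegral_sqr_le => //; [exact: measurable_slice1|exact: he|].
    by rewrite ortho// eqxx.
  rewrite -[LHS]sqrrN; congr (_ ^+ 2); rewrite /k opprB.
  rewrite (eq_RintegralT (fun y => (r N (x, y) + \sum_(i < N | s i != 0) s i * g i x * e i y) * e b y));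
    last by move=> y; rewrite /r/= subrK.
  rewrite (eq_RintegralT (fun y => r N (x, y) * e b y + (\sum_(i < N | s i != 0) s i * g i x * e i y) * e b y));
    last by move=> y; rewrite mulrDl.
  rewrite RintegralD//; [|by apply: L2M => //; exact: he..].
  rewrite -[RHS]addr0 -addrA; congr (_ + _).
  rewrite (eq_RintegralT (fun y => \sum_(i < N | s i != 0) (s i * g i x) * (e i y * e b y)));
    last by move=> y; rewrite mulr_suml; apply: eq_bigr => i _; rewrite mulrA.
  rewrite Rintegral_sum; last first.
    move=> i si; exact: (integrableZl measurableT (s i * g i x) (L2M (he i si) (he b sb))).
  rewrite (bigD1 (Ordinal bN))//= RintegralZl//; last by apply: L2M; exact: he.
  rewrite ortho// eqxx mulr1 big1 ?addr0 ?subrr// => i /andP[si ib].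
  rewrite RintegralZl//; last by apply: L2M; exact: he.
  by rewrite ortho// (negbTE (ib : i != b :> nat)) mulr0.
have k0 : (\int[mx]_x (k x ^+ 2)%:E = 0)%E.
  apply/eqP; rewrite eq_le; apply/andP; split; last first.
    by apply: integral_ge0 => x _; rewrite lee_fin sqr_ge0.
  apply: (cvge_ge _ hcvg); exists b.+1 => // N /= bN.
  apply: ge0_le_integral => //.
  - by move=> x _; rewrite lee_fin sqr_ge0.
  - exact: measurable_sqr.
  - apply: (measurable_fun_fubini_tonelli_F (fun z => (r N z ^+ 2)%:E)).
      exact: measurable_sqr.
    by move=> z; rewrite lee_fin sqr_ge0.
  - by move=> x _; exact: kr.
have := ge0_int_sqr_eq0 mk k0.
by apply: filterS => x /(_ I) /eqP; rewrite subr_eq0 => /eqP.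
Qed.

End product.

(** * Consequences of the Schmidt decomposition *)

Section schmidt_theory.
Context {R : realType} {d1 d2 : measure_display}.
Context {X : measurableType d1} {Y : measurableType d2}.
Variable mx : {sigma_finite_measure set X -> \bar R}.
Variable my : {sigma_finite_measure set Y -> \bar R}.
Variables (h : X * Y -> R) (lambda : nat -> R).
Variables (gamma : nat -> X -> R) (phi : nat -> Y -> R).
Hypothesis mh : measurable_fun setT h.
Hypothesis hS : Defs.schmidt mx my h lambda gamma phi.

Let s i := Num.sqrt (lambda i).

Lemma schmidt_s_neq0 i : (s i != 0) = (lambda i != 0).
Proof.
by rewrite /s sqrtr_eq0 -ltNge lt_neqAle eq_sym (schmidt_ge0 hS) andbT.
Qed.

Lemma schmidt_L2gamma i : L2 mx (gamma i).
Proof. by apply/Lfun2P; exact: schmidt_L2l hS _. Qed.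

Lemma schmidt_L2phi i : L2 my (phi i).
Proof. by apply/Lfun2P; exact: schmidt_L2r hS _. Qed.

Let r N z := h z - \sum_(i < N | s i != 0) s i * gamma i z.1 * phi i z.2.

Let L2_tensor_sum N : L2 (mx \x my)%E
  (fun z => \sum_(i < N | s i != 0) s i * gamma i z.1 * phi i z.2).
Proof.
apply: L2_sum => i _.
have := L2_tensor mx my (gamma i) (phi i) (schmidt_L2gamma i) (schmidt_L2phi i).
by move=> /(L2Z (s i)); under eq_fun do rewrite mulrA.
Qed.

Let mr N : measurable_fun setT (r N).
Proof. by apply: measurable_funB => //; exact: L2_measurable (L2_tensor_sum N). Qed.

(** Terms of zero weight vanish, so the sum can be restricted to the indices on which orthonormality
    is known. *)
Lemma schmidt_cvg_sqr :
  (\int[mx]_x \int[my]_y ((h (x, y) -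
      \sum_(i < N | s i != 0) s i * gamma i x * phi i y) ^+ 2)%:E)%E
    @[N --> \oo] --> 0%E.
Proof.
have := schmidt_cvg hS.
rewrite (_ : (fun N => _) = (fun N =>
  'N[(mx \x my)%E]_2%:E[EFin \o r N]%E)); last first.
  apply/funext => N; congr Lnorm; apply/funext => z /=; congr EFin; congr (_ - _).
  rewrite [RHS]big_mkcond; apply: eq_bigr => i _ /=.
  by case: ifPn => //; rewrite negbK /s => /eqP ->; rewrite !mul0r.
move=> /Lnorm2_cvg0; under eq_fun do rewrite integral_sqr_prod//.
by [].
Qed.

(** Convergence provides a remainder of squared norm at most 1, and adding back the square
    integrable partial sum recovers [h]. *)
Lemma schmidt_L2 : L2 (mx \x my)%E h.
Proof.
have /cvge0P := schmidt_cvg_sqr.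
have r0 N : (0 <= \int[mx]_x \int[my]_y (r N (x, y) ^+ 2)%:E)%E.
  apply: integral_ge0 => x _; apply: integral_ge0 => y _.
  by rewrite lee_fin sqr_ge0.
move=> /(_ r0 1 ltr01) [N /(_ N (leqnn _)) hN].
have : L2 (mx \x my)%E (r N).
  by apply/L2_prodP; split=> //; rewrite (le_lt_trans hN)// ltry.
move=> /L2D /(_ (L2_tensor_sum N)).
by under eq_fun do rewrite /r subrK.
Qed.

Lemma schmidt_left b : lambda b != 0 ->
  ae_eq mx setT (fun x => s b * gamma b x)
    (fun x => \int[my]_y (h (x, y) * phi b y)).
Proof.
rewrite -schmidt_s_neq0 => sb.
apply: (singular_relation mx my h s gamma phi) => // [i _|i _|i j|].
- exact: schmidt_L2gamma.
- exact: schmidt_L2phi.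
- by rewrite !schmidt_s_neq0; exact: schmidt_orthor hS _ _.
- exact: schmidt_cvg_sqr.
Qed.

Lemma schmidt_right b : lambda b != 0 ->
  ae_eq my setT (fun y => s b * phi b y)
    (fun y => \int[mx]_x (h (x, y) * gamma b x)).
Proof.
rewrite -schmidt_s_neq0 => sb.
apply: (singular_relation my mx (fun z => h (z.2, z.1)) s phi gamma) => // [|i _|i _|i j|].
- exact: (measurableT_comp mh (measurable_fun_pair measurable_snd measurable_fst)).
- exact: schmidt_L2phi.
- exact: schmidt_L2gamma.
- by rewrite !schmidt_s_neq0; exact: schmidt_orthol hS _ _.
- apply: cvg_trans schmidt_cvg_sqr; apply: near_eq_cvg; near=> N.
  rewrite (integral_sqr_swap mx my (r N))//; apply: eq_integral => y _.
  apply: eq_integral => x _; congr (EFin (_ ^+ 2)); rewrite /r/=; congr (_ - _).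
  by apply: eq_bigr => i _; rewrite mulrAC.
Unshelve. all: by end_near. Qed.

(** The inductive step of the convergence: [t N b] approximates the weighted right singular
    function, with error [e N b]. The new remainder is [r N] plus the combination of the [gamma b]
    with coefficients [e N b y], and by orthonormality the square of the latter integrates over x to
    the sum of the [e N b y ^+ 2]. *)
Lemma schmidt_substitute (t : nat -> nat -> Y -> R) :
  (forall N b, measurable_fun setT (t N b)) ->
  (forall N b, lambda b = 0 -> ae_eq my setT (t N b) (fun=> 0)) ->
  (\sum_(b <oo) \int[my]_y ((s b * phi b y - t N b y) ^+ 2)%:E)%E
    @[N --> \oo] --> 0%E ->
  (\int[mx]_x \int[my]_y ((h (x, y) - \sum_(b < N) gamma b x * t N b y) ^+ 2)%:E)%E
    @[N --> \oo] --> 0%E.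
Proof.
move=> mt t0 tcvg.
pose e N b y := s b * phi b y - t N b y.
pose k N z := h z - \sum_(b < N) gamma b z.1 * t N b z.2.
have me N b : measurable_fun setT (e N b).
  apply: measurable_funB => //; apply: measurable_funM => //.
  exact: L2_measurable (schmidt_L2phi b).
have mgt N b : measurable_fun setT (fun z : X * Y => gamma b z.1 * t N b z.2).
  apply: measurable_funM.
    exact: (measurableT_comp (L2_measurable (schmidt_L2gamma b)) measurable_fst).
  exact: (measurableT_comp (mt N b) measurable_snd).
have mk N : measurable_fun setT (k N).
  by apply: measurable_funB => //; apply: measurable_sum_cond.
have mge N : measurable_fun setT (fun z : X * Y =>
    \sum_(b < N | s b != 0) e N b z.2 * gamma b z.1).
  apply: measurable_sum_cond => b _; apply: measurable_funM.
    exact: (measurableT_comp (me N b) measurable_snd).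
  exact: (measurableT_comp (L2_measurable (schmidt_L2gamma b)) measurable_fst).
have sq0 (T : Type) (f : T -> R) x : (0 <= (f x ^+ 2)%:E)%E.
  by rewrite lee_fin sqr_ge0.
have mint (g : X * Y -> R) : measurable_fun setT g ->
    measurable_fun setT (fun y => \int[mx]_x (g (x, y) ^+ 2)%:E)%E.
  move=> mg; apply: (measurable_fun_fubini_tonelli_G (fun z => (g z ^+ 2)%:E)) => //.
  exact: measurable_sqr.
have bound N : (\int[mx]_x \int[my]_y (k N (x, y) ^+ 2)%:E <=
    2%:E * \int[mx]_x \int[my]_y (r N (x, y) ^+ 2)%:E +
    2%:E * \sum_(b <oo) \int[my]_y (e N b y ^+ 2)%:E)%E.
  rewrite !integral_sqr_swap//.
  (* A single null set serves for all [b]; outside it, every [gamma b] of zero weight is multiplied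
     by 0. *)
  have aet : {ae my, forall y, forall b, s b = 0 -> t N b y = 0}.
    have := @ae_foralln _ Y R my (fun b y => s b = 0 -> t N b y = 0).
    apply=> b; have [sb|sb] := eqVneq (s b) 0; last first.
      by apply: aeW => y /eqP; rewrite (negbTE sb).
    have : lambda b = 0 by apply/eqP; rewrite -[_ == _]negbK -schmidt_s_neq0 sb eqxx.
    by move=> /t0 => /(_ N); apply: filterS => y /(_ I) -> _.
  have ptw : {ae my, forall y, (\int[mx]_x (k N (x, y) ^+ 2)%:E <=
      2%:E * \int[mx]_x (r N (x, y) ^+ 2)%:E +
      2%:E * (\sum_(b < N | s b != 0%R) e N b y ^+ 2)%:E)%E}.
    apply: filterS aet => y ty.
    rewrite -(int_sqr_sum mx gamma (fun b => e N b y) (fun b => s b != 0)); last 2 first.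
      by move=> i _; exact: schmidt_L2gamma.
      by move=> i j; rewrite !schmidt_s_neq0; exact: schmidt_orthol hS _ _.
    have mk1 := measurable_sqr _ (measurable_slice2 _ y (mk N)).
    have mr1 := measurable_sqr _ (measurable_slice2 _ y (mr N)).
    have mge1 := measurable_sqr _ (measurable_slice2 _ y (mge N)).
    rewrite -!ge0_integralZl//.
    rewrite -ge0_integralD//; last 4 first.
    - by move=> x _; rewrite mule_ge0// lee_fin sqr_ge0.
    - exact: measurable_funeM.
    - by move=> x _; rewrite mule_ge0// lee_fin sqr_ge0.
    - exact: measurable_funeM.
    apply: ge0_le_integral => //.
    - by apply: emeasurable_funD; exact: measurable_funeM.
    move=> x _; rewrite -!EFinM -EFinD lee_fin.
    have -> : k N (x, y) = r N (x, y) + \sum_(b < N | s b != 0) e N b y * gamma b x.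
      rewrite /k /r/= -addrA; congr (_ + _).
      rewrite (bigID (fun b : 'I_N => s b != 0))/= [X in _ + X]big1 ?addr0; last first.
        by move=> b; rewrite negbK => /eqP sb; rewrite ty// mulr0.
      rewrite -!sumrN -big_split/=; apply: eq_bigr => b _; rewrite /e; ring.
    (* $2u^2+2v^2-(u+v)^2=(u-v)^2$. *)
    set u := r N _; set v := \sum_(_ < _ | _) _.
    by rewrite -subr_ge0; have := sqr_ge0 (u - v); lra.
  apply: (@le_trans _ _ (\int[my]_y (2%:E * \int[mx]_x (r N (x, y) ^+ 2)%:E +
      2%:E * (\sum_(b < N | s b != 0%R) e N b y ^+ 2)%:E))%E).
    apply: ae_ge0_le_integral => //.
    - by move=> y _; apply: integral_ge0 => x _; rewrite (sq0 _ (fun x => k N (x, y))).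
    - exact: mint.
    - move=> y _; rewrite adde_ge0// mule_ge0//; last first.
        by rewrite lee_fin sumr_ge0// => b _; rewrite sqr_ge0.
      by apply: integral_ge0 => x _; rewrite (sq0 _ (fun x => r N (x, y))).
    - apply: emeasurable_funD; apply: measurable_funeM; first exact: mint.
      apply/measurable_EFinP; apply: measurable_sum_cond => b _.
      exact: measurable_funX.
    - by apply: filterS ptw => y + _.
  rewrite ge0_integralD//; last 4 first.
  - move=> y _; rewrite mule_ge0//.
    by apply: integral_ge0 => x _; rewrite (sq0 _ (fun x => r N (x, y))).
  - by apply: measurable_funeM; exact: mint.
  - by move=> y _; rewrite mule_ge0// lee_fin sumr_ge0// => b _; rewrite sqr_ge0.
  - apply: measurable_funeM; apply/measurable_EFinP.
    by apply: measurable_sum_cond => b _; exact: measurable_funX.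
  rewrite !ge0_integralZl//; last 4 first.
  - apply/measurable_EFinP.
    by apply: measurable_sum_cond => b _; exact: measurable_funX.
  - by move=> y _; rewrite lee_fin sumr_ge0// => b _; rewrite sqr_ge0.
  - exact: mint.
  - move=> y _.
    by apply: integral_ge0 => x _; rewrite (sq0 _ (fun x => r N (x, y))).
  rewrite leeD2l// lee_pmul2l//.
  rewrite (eq_integral (fun y => \sum_(b < N) (if s b != 0%R then (e N b y ^+ 2)%:E else 0))%E);
    last by move=> y _; rewrite -sumEFin big_mkcond.
  rewrite ge0_integral_sum//; last 2 first.
  - move=> b; case: (s b != 0); last exact: measurable_cst.
    exact: measurable_sqr.
  - by move=> b y _; case: ifPn => // _; exact: sq0.
  (* The terms of zero weight are added back, then those from [N] on, to reach the whole series. *)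
  apply: (@le_trans _ _ (\sum_(0 <= b < N) \int[my]_y (e N b y ^+ 2)%:E)%E).
    rewrite big_mkord; apply: lee_sum => b _.
    case: (s b != 0) => //; rewrite integral0.
    by apply: integral_ge0 => y _; exact: sq0.
  apply: nneseries_lim_ge => b _ _.
  by apply: integral_ge0 => y _; exact: sq0.
apply: (@squeeze_cvge _ _ _ _ (fun=> 0%E) _ (fun N =>
    2%:E * \int[mx]_x \int[my]_y (r N (x, y) ^+ 2)%:E +
    2%:E * \sum_(b <oo) \int[my]_y (e N b y ^+ 2)%:E)%E).
- apply: nearW => N; rewrite bound andbT.
  apply: integral_ge0 => x _; apply: integral_ge0 => y _.
  by rewrite lee_fin sqr_ge0.
- exact: cvg_cst.
- rewrite -[X in _ --> X](_ : 2%:E * 0 + 2%:E * 0 = 0)%E; last by rewrite !mule0 adde0.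
  apply: cvgeD => //.
  + by apply: cvgeZl => //; exact: schmidt_cvg_sqr.
  + by apply: cvgeZl.
Qed.

End schmidt_theory.

(** * Product measures on boxes *)

Section box.
Context {R : realType}.
Implicit Types n : nat.

Lemma thead_tuple_cons n (x : R) (y : n.-tuple R) : thead (tuple_cons (x, y)) = x.
Proof. by []. Qed.

Lemma behead_tuple_cons n (x : R) (y : n.-tuple R) :
  behead_tuple (tuple_cons (x, y)) = y.
Proof. exact: val_inj. Qed.

Lemma tnth_tuple_cons0 n (z : R * n.-tuple R) : tnth (tuple_cons z) ord0 = z.1.
Proof. by rewrite (tnth_nth 0). Qed.

Lemma tnth_tuple_consS n (z : R * n.-tuple R) (i : 'I_n) :
  tnth (tuple_cons z) (lift ord0 i) = tnth z.2 i.
Proof. by rewrite !(tnth_nth 0). Qed.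

Lemma measurable_thead n : measurable_fun setT (@thead n R).
Proof. exact: measurable_tnth. Qed.

Lemma measurable_behead n :
  measurable_fun setT (fun y : n.+1.-tuple R => behead_tuple y : n.-tuple R).
Proof.
apply/measurable_fun_tnthP => i.
rewrite (_ : _ \o _ = (fun y => tnth y (lift ord0 i))); first exact: measurable_tnth.
by apply/funext => y /=; rewrite !(tnth_nth 0)/= nth_behead.
Qed.

Variable n : nat.
Variable mu : 'I_n.+1 -> {finite_measure set R -> \bar R}.
Let mu0 := mu ord0.
Let nu := box_measure (fun i => mu (lift ord0 i)).

Lemma ge0_integral_box_prod (g : n.+1.-tuple R -> \bar R) :
  measurable_fun setT g -> (forall x, 0 <= g x)%E ->
  (\int[box_measure mu]_x g x = \int[(mu0 \x nu)%E]_z g (tuple_cons z))%E.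
Proof.
move=> mg g0.
have := @ge0_integral_pushforward _ _ (R * n.-tuple R)%type _ R (@tuple_cons R n)
  (@measurable_tuple_cons _ _ n) (mu0 \x nu)%E setT g measurableT mg (fun y _ => g0 y).
by rewrite preimage_setT => <-.
Qed.

Lemma ge0_integral_box (g : n.+1.-tuple R -> \bar R) :
  measurable_fun setT g -> (forall x, 0 <= g x)%E ->
  (\int[box_measure mu]_x g x =
   \int[mu0]_x \int[nu]_y g (tuple_cons (x, y)))%E.
Proof.
move=> mg g0; rewrite ge0_integral_box_prod// fubini_tonelli1//=.
exact: measurableT_comp mg (@measurable_tuple_cons _ _ n).
Qed.

Lemma L2_boxP (f : n.+1.-tuple R -> R) : measurable_fun setT f ->
  L2 (box_measure mu) f <-> L2 (mu0 \x nu)%E (fun z => f (tuple_cons z)).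
Proof.
move=> mf.
have sq0 x : (0 <= (f x ^+ 2)%:E)%E by rewrite lee_fin sqr_ge0.
have h := ge0_integral_box_prod _ (measurable_sqr _ mf) sq0.
split=> -[m fin]; split=> //; [|by rewrite -h|by rewrite h].
exact: measurableT_comp mf (@measurable_tuple_cons _ _ n).
Qed.

End box.

(* The library only declares the mixin, not the full sigma-finite structure. *)
HB.instance Definition _ (R : realType) := Measure_isSigmaFinite.Build _ _ _
  (@counting nat R) (sigma_finite_counting R).

Section natprod.
Context {R : realType} {d : measure_display} {Y : measurableType d}.

Lemma measurable_natprod d' (Z : measurableType d') (f : nat * Y -> Z) :
  (forall a, measurable_fun setT (fun y => f (a, y))) -> measurable_fun setT f.
Proof.
move=> mf _ B mB; rewrite setTI.
rewrite (_ : f @^-1` B = \bigcup_a ([set a] `*` ((fun y => f (a, y)) @^-1` B))).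
  apply: bigcup_measurable => a _; apply: measurableX => //.
  by rewrite -[X in measurable X]setTI; exact: mf.
apply/seteqP; split=> [[a y] /= fay|[a y] [b _ [/= ->]]//].
by exists a => //.
Qed.

Lemma ge0_integral_counting_prod (m : {finite_measure set R -> \bar R})
    (g : nat * R -> \bar R) : measurable_fun setT g -> (forall z, 0 <= g z)%E ->
  (\int[counting_product m]_z g z = \sum_(a <oo) \int[m]_x g (a, x))%E.
Proof.
move=> mg g0.
pose c : {sigma_finite_measure set nat -> \bar R} := @counting nat R.
have := @fubini_tonelli1 _ _ nat R R c m g mg g0.
rewrite /fubini_F ge0_integral_count; last by move=> a; exact: integral_ge0.
exact.
Qed.

End natprod.

(** * Convergence of the partial sums *)

Section partial_sums.
Context {R : realType}.

Lemma nneseries_ge_term (u : nat -> \bar R) a : (forall i, 0 <= u i)%E ->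
  (u a <= \sum_(i <oo) u i)%E.
Proof.
move=> u0; apply: (@le_trans _ _ (\sum_(0 <= i < a.+1) u i)%E); last exact: nneseries_lim_ge.
rewrite big_nat_recr//= leeDr//.
by apply: sume_ge0.
Qed.

(** Each index has mass 1 for the counting measure, so a null set meets every row in a null set.
    Here the integrals of $(f-g)^2$ over the rows are nonnegative with sum 0. *)
Lemma ae_eq_counting_slice (m : {finite_measure set R -> \bar R})
    (f g : nat * R -> R) (a : nat) :
  measurable_fun setT f -> measurable_fun setT g ->
  ae_eq (counting_product m) setT f g ->
  ae_eq m setT (fun x => f (a, x)) (fun x => g (a, x)).
Proof.
move=> mf mg fg.
have mfg : measurable_fun setT (fun z => f z - g z) by exact: measurable_funB.
have : (\int[counting_product m]_z ((f z - g z) ^+ 2)%:E = 0)%E.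
  rewrite (ae_eq_integral (cst 0%E) (fun z => ((f z - g z) ^+ 2)%:E))//.
  - by rewrite integral0.
  - exact: measurable_sqr.
  - by apply: filterS fg => z /(_ I) -> _; rewrite subrr expr0n.
rewrite ge0_integral_counting_prod; last 2 first.
- exact: measurable_sqr.
- by move=> z; rewrite lee_fin sqr_ge0.
have i0 b : (0 <= \int[m]_x ((f (b, x) - g (b, x)) ^+ 2)%:E)%E.
  by apply: integral_ge0 => x _; rewrite lee_fin sqr_ge0.
move=> s0; have h0 : (\int[m]_x ((f (a, x) - g (a, x)) ^+ 2)%:E = 0)%E.
  by apply/eqP; rewrite eq_le i0 andbT -s0 (nneseries_ge_term _ a i0).
have := ge0_int_sqr_eq0 (measurable_slice1 _ a mfg) h0.
by apply: filterS => x /(_ I) /eqP; rewrite subr_eq0 => /eqP.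
Qed.

(** The truncated sum over the indices that follow the row index [a], nested so as to match the
    recursion of [ftt_from]; [ftt_restE] expands it into a sum over index functions. *)
Fixpoint ftt_rest n : ('I_n.+1 -> nat -> R -> nat -> R) -> nat -> nat ->
    n.+1.-tuple R -> R :=
  match n with
  | 0 => fun gamma N a y => gamma ord0 a (thead y) 0%N
  | m.+1 => fun gamma N a y =>
      \sum_(b < N) gamma ord0 a (thead y) b *
        ftt_rest m (fun i => gamma (lift ord0 i)) N b (behead_tuple y)
  end.

(** Convertible to the kernel that [ftt_from] hands to [schmidt]. *)
Definition row_kernel n (h : nat -> n.+1.-tuple R -> R) :
    (nat * R) * n.-tuple R -> R :=
  fun z => h z.1.1 (tuple_cons (z.1.2, z.2)).

Lemma measurable_row_kernel n (h : nat -> n.+1.-tuple R -> R) :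
  (forall a, measurable_fun setT (h a)) -> measurable_fun setT (row_kernel n h).
Proof.
move=> mh.
have mk : measurable_fun setT (fun z : nat * (R * n.-tuple R) => h z.1 (tuple_cons z.2)).
  apply: measurable_natprod => a /=.
  exact: measurableT_comp (mh a) (@measurable_tuple_cons _ _ n).
apply: (measurableT_comp mk (g := fun z : (nat * R) * n.-tuple R => (z.1.1, (z.1.2, z.2)))).
apply: measurable_fun_pair.
  exact: (measurableT_comp measurable_fst measurable_fst).
apply: measurable_fun_pair => //.
exact: (measurableT_comp measurable_snd measurable_fst).
Qed.

(** The claims are proved together because [schmidt_substitute] at one level consumes all three at
    the next: the second removes the singular functions of zero weight, whose row in the next kernel
    is zero, and the third is the total error over all rows. *)
Lemma ftt_from_rest n (mu : 'I_n.+1 -> {finite_measure set R -> \bar R}) h lambda gamma :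
  (forall a, measurable_fun setT (h a)) -> ftt_from mu h lambda gamma ->
  [/\ forall N a, measurable_fun setT (ftt_rest n gamma N a),
      forall N a, (forall y, h a y = 0) ->
        ae_eq (box_measure mu) setT (ftt_rest n gamma N a) (fun=> 0) &
      (\sum_(a <oo) \int[box_measure mu]_y ((h a y - ftt_rest n gamma N a y) ^+ 2)%:E)%E
        @[N --> \oo] --> 0%E].
Proof.
elim: n mu h lambda gamma => [|n ih] mu h lambda gamma mh.
  move=> hE; have {}hE : forall a x, gamma ord0 a x 0%N = h a [tuple x] := hE.
  (* The last core is the kernel itself, so the error is 0 at this level. *)
  have rE N a : ftt_rest 0 gamma N a = h a.
    apply/funext => y /=; rewrite hE; congr h; apply: val_inj.
    by case: y => -[|x []].
  split.
  - by move=> N a; rewrite rE.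
  - by move=> N a h0; rewrite rE; apply: aeW => y _; rewrite h0.
  - under eq_fun do under eq_eseriesr do under eq_integral do
      rewrite rE subrr expr0n/=.
    under eq_fun do under eq_eseriesr do rewrite integral0.
    under eq_fun do rewrite eseries0//.
    exact: cvg_cst.
move=> [phi hS hft].
have mH := measurable_row_kernel _ h mh.
have mphi b := L2_measurable (schmidt_L2phi _ _ _ _ _ _ hS b).
have mgamma b := L2_measurable (schmidt_L2gamma _ _ _ _ _ _ hS b).
have mh' b : measurable_fun setT (fun y => Num.sqrt (lambda ord0 b) * phi b y).
  by apply: measurable_funM => //; exact: mphi.
have [mr zr cr] := ih _ _ _ _ mh' hft.
set rest := ftt_rest n (fun i => gamma (lift ord0 i)) in mr zr cr.
have mgr N b : measurable_fun setT (fun z : nat * (n.+2.-tuple R) =>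
    gamma ord0 z.1 (thead z.2) b * rest N b (behead_tuple z.2)).
  apply: measurable_natprod => a /=; apply: measurable_funM.
    exact: (measurableT_comp (measurable_slice1 _ a (mgamma b)) (measurable_thead n.+1)).
  exact: (measurableT_comp (mr N b) (measurable_behead _)).
have mrest N a : measurable_fun setT (ftt_rest n.+1 gamma N a).
  apply: measurable_sum_cond => b _.
  exact: (measurable_slice1 _ a (mgr N b)).
have zr' N b : lambda ord0 b = 0 -> ae_eq (box_measure (fun i => mu (lift ord0 i)))
    setT (rest N b) (fun=> 0).
  by move=> l0; apply: zr => y; rewrite l0 sqrtr0 mul0r.
split=> //.
- move=> N a h0.
  have mabs : measurable_fun setT (fun y => `|(ftt_rest n.+1 gamma N a y)%:E|%E).
    by apply: measurableT_comp => //; apply/measurable_EFinP.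
  suff : (\int[box_measure mu]_y `|(ftt_rest n.+1 gamma N a y)%:E| = 0)%E.
    have mE : measurable_fun setT (fun y => (ftt_rest n.+1 gamma N a y)%:E : \bar R).
      exact/measurable_EFinP.
    move=> /(ae_eq_integral_abs (box_measure mu) measurableT mE).
    by apply: filterS => y /(_ I) [].
  rewrite ge0_integral_box//.
  (* For nonzero [lambda ord0 b], the weighted core is the integral of the zero row against [phi b],
     hence vanishes almost everywhere; for zero [lambda ord0 b] the other factor does ([aer]). *)
  have aeg : {ae mu ord0, forall x, forall b, lambda ord0 b != 0 -> gamma ord0 a x b = 0}.
    have := @ae_foralln _ R R (mu ord0) (fun b x => lambda ord0 b != 0 -> gamma ord0 a x b = 0).
    apply=> b; have [l0|lb] := eqVneq (lambda ord0 b) 0.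
      by apply: aeW => x.
    have := schmidt_left _ _ _ _ _ _ mH hS b lb.
    have m1 : measurable_fun setT (fun z : nat * R =>
        Num.sqrt (lambda ord0 b) * gamma ord0 z.1 z.2 b).
      by apply: measurable_funM => //; exact: mgamma.
    have m2 : measurable_fun setT (fun z =>
      \int[box_measure (fun i => mu (lift ord0 i))]_y (row_kernel _ h (z, y) * phi b y)).
      apply: (measurable_Rintegral1 _ (fun w => row_kernel _ h w * phi b w.2)).
      by apply: measurable_funM => //; exact: (measurableT_comp (mphi b) measurable_snd).
    move=> /(ae_eq_counting_slice _ _ _ a m1 m2); apply: filterS => x /(_ I) /=.
    under eq_Rintegral do rewrite /row_kernel/= h0 mul0r.
    rewrite Rintegral_cst// mul0r => /eqP; rewrite mulf_eq0.
    by rewrite -[_ == 0]negbK (schmidt_s_neq0 _ _ _ _ _ _ hS) lb/= => /eqP.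
  have aer : {ae box_measure (fun i => mu (lift ord0 i)), forall y,
      forall b, lambda ord0 b = 0 -> rest N b y = 0}.
    have := @ae_foralln _ _ R (box_measure (fun i => mu (lift ord0 i)))
      (fun b y => lambda ord0 b = 0 -> rest N b y = 0).
    apply=> b; have [l0|lb] := eqVneq (lambda ord0 b) 0.
      by apply: filterS (zr' N b l0) => y /(_ I) ->.
    by apply: aeW => y /eqP; rewrite (negbTE lb).
  rewrite (ae_eq_integral (cst 0%E))//; first by rewrite integral0.
    have mab : measurable_fun setT (fun z => `|(ftt_rest n.+1 gamma N a (tuple_cons z))%:E|%E).
      exact: measurableT_comp mabs (@measurable_tuple_cons _ _ n.+1).
    exact: (measurable_fun_fubini_tonelli_F _ mab).
  apply: filterS aeg => x gx _.
  rewrite (ae_eq_integral (cst 0%E))//; first by rewrite integral0.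
    have mab : measurable_fun setT (fun z => `|(ftt_rest n.+1 gamma N a (tuple_cons z))%:E|%E).
      exact: measurableT_comp mabs (@measurable_tuple_cons _ _ n.+1).
    exact: (measurableT_comp mab (pair1_measurable x)).
  apply: filterS aer => y ry _ /=.
  rewrite big1 ?normr0// => b _; rewrite thead_tuple_cons behead_tuple_cons.
  have [l0|lb] := eqVneq (lambda ord0 b) 0; first by rewrite -/rest ry// mulr0.
  by rewrite gx// mul0r.
- have := schmidt_substitute _ _ _ _ _ _ mH hS rest mr zr' cr.
  apply: cvg_trans; apply: near_eq_cvg; near=> N.
  have msq a : measurable_fun setT (fun y => ((h a y - ftt_rest n.+1 gamma N a y) ^+ 2)%:E : \bar R).
    by apply: measurable_sqr; apply: measurable_funB.
  have sq0 a y : (0 <= ((h a y - ftt_rest n.+1 gamma N a y) ^+ 2)%:E)%E.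
    by rewrite lee_fin sqr_ge0.
  have EH z y : row_kernel n.+1 h (z, y) - \sum_(b < N) gamma ord0 z.1 z.2 b * rest N b y =
      h z.1 (tuple_cons (z.2, y)) - ftt_rest n.+1 gamma N z.1 (tuple_cons (z.2, y)).
    by rewrite /= thead_tuple_cons behead_tuple_cons.
  under [LHS]eq_integral do under eq_integral do rewrite EH.
  rewrite ge0_integral_counting_prod; last 2 first.
  - apply: measurable_natprod => a /=.
    have mt : measurable_fun setT (fun z => ((h a (tuple_cons z) - ftt_rest n.+1 gamma N a (tuple_cons z)) ^+ 2)%:E : \bar R).
      exact: measurableT_comp (msq a) (@measurable_tuple_cons _ _ n.+1).
    exact: (measurable_fun_fubini_tonelli_F _ mt).
  - by move=> z; apply: integral_ge0.
  by apply: eq_eseriesr => a _; rewrite ge0_integral_box.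
Unshelve. all: by end_near. Qed.

End partial_sums.

Section convergence.
Context {R : realType}.

(** [ftt_index] with an arbitrary starting value instead of 0, because peeling off the first core
    changes the index at which the product starts. *)
Definition ftt_index_from (a m N : nat) (s : {ffun 'I_m -> 'I_N}) (i : nat) : nat :=
  if i is i'.+1 then
    if insub i' is Some l then nat_of_ord (s l) else 0%N
  else a.

Local Arguments ftt_index_from : simpl never.

Lemma sum_ffunS m N (F : {ffun 'I_m.+1 -> 'I_N} -> R) :
  \sum_s F s = \sum_(b < N) \sum_(t : {ffun 'I_m -> 'I_N})
    F [ffun i => if unlift ord0 i is Some i' then t i' else b].
Proof.
rewrite pair_big/=.
pose J (p : 'I_N * {ffun 'I_m -> 'I_N}) : {ffun 'I_m.+1 -> 'I_N} :=
  [ffun i => if unlift ord0 i is Some i' then p.2 i' else p.1].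
rewrite (reindex J)//=; exists (fun s => (s ord0, [ffun i => s (lift ord0 i)])).
- move=> [b t] _; rewrite /J/=; congr pair; first by rewrite ffunE unlift_none.
  by apply/ffunP => i; rewrite !ffunE liftK.
- move=> s _; apply/ffunP => i; rewrite /J ffunE/=.
  by case: unliftP => [j ->|->//]; rewrite ffunE.
Qed.

Lemma ftt_restE m N (gamma : 'I_m.+1 -> nat -> R -> nat -> R) a (x : m.+1.-tuple R) :
  ftt_rest m gamma N a x =
  \sum_(s : {ffun 'I_m -> 'I_N}) \prod_(j < m.+1)
    gamma j (ftt_index_from a m N s j) (tnth x j) (ftt_index_from a m N s j.+1).
Proof.
elim: m gamma a x => [|m ih] gamma a x.
  (* There is exactly one index function on ['I_0], the empty one. *)
  have s0 : {ffun 'I_0 -> 'I_N} by apply: finfun; case.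
  rewrite (bigD1 s0)//= [X in _ + X]big1 ?addr0; last first.
    by move=> s /eqP ss0; exfalso; apply: ss0; apply/ffunP; case.
  rewrite big_ord_recl big_ord0 mulr1 /ftt_index_from/=; case: insubP => [[]//|_ //].
rewrite sum_ffunS /=; apply: eq_bigr => b _; rewrite ih big_distrr/=.
apply: eq_bigr => t _; rewrite [RHS]big_ord_recl.
set s := [ffun i => _].
(* Removing the first entry [b] of the index function turns it into the new starting value. *)
have idxS i : ftt_index_from a m.+1 N s i.+1 = ftt_index_from b m N t i.
  rewrite /ftt_index_from; case: i => [|i] /=.
    by rewrite (insubT (fun k => k < m.+1)%N (ltn0Sn m))/= ffunE unlift_none.
  case: insubP => /= [u ui uE|].
    have ji : (i < m)%N by [].
    rewrite (insubT (fun k => k < m)%N ji)/=.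
    rewrite ffunE (_ : u = lift ord0 (Ordinal ji)) ?liftK//.
    by apply: val_inj; rewrite /= uE /bump add1n.
  rewrite ltnS => im; case: insubP => //= u ui.
  by rewrite ui in im.
congr (_ * _); first by rewrite idxS.
apply: eq_bigr => j _; rewrite lift0 !idxS.
by congr (gamma _ _ _ _); [rewrite !(tnth_nth 0)/= nth_behead].
Qed.

Lemma ftt_sumE n N (gamma : 'I_n.+2 -> nat -> R -> nat -> R) (x : n.+2.-tuple R) :
  ftt_sum N gamma x = \sum_(b < N) gamma ord0 0%N (thead x) b *
    ftt_rest n (fun i => gamma (lift ord0 i)) N b (behead_tuple x).
Proof. by rewrite -[RHS]/(ftt_rest n.+1 gamma N 0 x) ftt_restE. Qed.

(** The first kernel has no row index, so [schmidt_substitute] is applied once more, this time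
    without the counting measure, on top of [ftt_from_rest]. *)
Lemma ftt_sum_cvg n (mu : 'I_n.+2 -> {finite_measure set R -> \bar R})
    (f : n.+2.-tuple R -> R) lambda gamma :
  measurable_fun setT f -> is_ftt mu f lambda gamma ->
  'N[box_measure mu]_2%:E[EFin \o (fun x => f x - ftt_sum N gamma x)%R]%E
     @[N --> \oo] --> 0%E.
Proof.
move=> mf [phi hS hft]; apply/Lnorm2_cvg0.
have mH : measurable_fun setT (fun z => f (tuple_cons z)).
  exact: measurableT_comp mf (@measurable_tuple_cons _ _ n.+1).
have mphi b := L2_measurable (schmidt_L2phi _ _ _ _ _ _ hS b).
have mgamma b := L2_measurable (schmidt_L2gamma _ _ _ _ _ _ hS b).
have mh' b : measurable_fun setT (fun y => Num.sqrt (lambda ord0 b) * phi b y).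
  by apply: measurable_funM => //; exact: mphi.
have [mr zr cr] := ftt_from_rest _ _ _ _ _ mh' hft.
set rest := ftt_rest n (fun i => gamma (lift ord0 i)) in mr zr cr.
have zr' N b : lambda ord0 b = 0 -> ae_eq (box_measure (fun i => mu (lift ord0 i)))
    setT (rest N b) (fun=> 0).
  by move=> l0; apply: zr => y; rewrite l0 sqrtr0 mul0r.
have := schmidt_substitute _ _ _ _ _ _ mH hS rest mr zr' cr.
apply: cvg_trans; apply: near_eq_cvg; near=> N.
have msum : measurable_fun setT (ftt_sum N gamma).
  rewrite (_ : ftt_sum N gamma = (fun x => \sum_(b < N) gamma ord0 0%N (thead x) b * rest N b (behead_tuple x))).
    apply: measurable_sum_cond => b _; apply: measurable_funM.
      exact: (measurableT_comp (mgamma b) (measurable_thead n.+1)).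
    exact: (measurableT_comp (mr N b) (measurable_behead _)).
  by apply/funext => x; rewrite ftt_sumE.
rewrite [RHS]ge0_integral_box; last 2 first.
- by apply: measurable_sqr; exact: measurable_funB.
- by move=> x; rewrite lee_fin sqr_ge0.
apply: eq_integral => x _; apply: eq_integral => y _.
by rewrite ftt_sumE thead_tuple_cons behead_tuple_cons.
Unshelve. all: by end_near. Qed.

End convergence.

(** * Differentiation in one coordinate, tested on the others *)

Section fubini_real.
Context {R : realType} {d1 d2 : measure_display}.
Context {X : measurableType d1} {Y : measurableType d2}.
Variable mx : {sigma_finite_measure set X -> \bar R}.
Variable my : {sigma_finite_measure set Y -> \bar R}.
Variable k : X * Y -> R.
Hypothesis ik : (mx \x my)%E.-integrable setT (EFin \o k).

(** [Rintegral] sends an infinite inner integral to 0, so the real iterated integral matches that of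
    Fubini's theorem only off the null set of slices that are not integrable. *)
Lemma Rintegral12 : \int[mx]_x \int[my]_y k (x, y) = \int[(mx \x my)%E]_z k z.
Proof.
have mk : measurable_fun setT k by apply/measurable_EFinP; exact: measurable_int ik.
rewrite /Rintegral -(integral12_prod_meas1 ik); congr fine.
apply: ae_eq_integral => //.
- by apply/measurable_EFinP; exact: measurable_Rintegral1.
- exact: (measurable_fubini_F ik).
- apply: filterS (ae_integrable1 ik) => x ikx _.
  by rewrite -[RHS]fineK// integrable_fin_num.
Qed.

Lemma Rintegral21 : \int[my]_y \int[mx]_x k (x, y) = \int[(mx \x my)%E]_z k z.
Proof.
have mk : measurable_fun setT k by apply/measurable_EFinP; exact: measurable_int ik.
rewrite /Rintegral -(integral21_prod_meas1 ik); congr fine.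
apply: ae_eq_integral => //.
- apply/measurable_EFinP; apply: (measurable_Rintegral1 mx (fun z => k (z.2, z.1))).
  exact: (measurableT_comp mk (measurable_fun_pair measurable_snd measurable_fst)).
- exact: (measurable_fubini_G ik).
- apply: filterS (ae_integrable2 ik) => x ikx _.
  by rewrite -[RHS]fineK// integrable_fin_num.
Qed.

Lemma integrable_Rintegral1 :
  mx.-integrable setT (EFin \o (fun x => \int[my]_y k (x, y))).
Proof.
have mk : measurable_fun setT k by apply/measurable_EFinP; exact: measurable_int ik.
have iF := integrable_fubini_F ik.
have mF : measurable_fun setT (fun x => \int[my]_y k (x, y)).
  exact: measurable_Rintegral1.
apply/integrableP; split; first exact/measurable_EFinP.
have /integrableP[_] := iF; apply: le_lt_trans.
apply: ge0_le_integral => //.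
- by apply: measurableT_comp => //; exact/measurable_EFinP.
- by apply: measurableT_comp => //; exact: (measurable_fubini_F ik).
- move=> x _ /=; rewrite /Rintegral /fubini_F /=.
  by case: (\int[my]_y (k (x, y))%:E)%E => [r||]//=; rewrite normr0 leey.
Qed.

End fubini_real.

Lemma ae_eq_Rintegral {R : realType} d (T : measurableType d)
    (mu : {measure set T -> \bar R}) (g f : T -> R) :
  measurable_fun setT f -> measurable_fun setT g -> ae_eq mu setT f g ->
  \int[mu]_x f x = \int[mu]_x g x.
Proof.
move=> mf mg fg; congr fine; apply: ae_eq_integral => //.
- exact/measurable_EFinP.
- exact/measurable_EFinP.
- by apply: filterS fg => x fg Dx; rewrite fg.
Qed.

Lemma Rintegral_counting_prod_eq {R : realType} (m : {finite_measure set R -> \bar R})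
    (F G : nat * R -> R) :
  (counting_product m).-integrable setT (EFin \o F) ->
  (counting_product m).-integrable setT (EFin \o G) ->
  (forall a, \int[m]_x F (a, x) = \int[m]_x G (a, x)) ->
  \int[counting_product m]_z F z = \int[counting_product m]_z G z.
Proof.
move=> iF iG FG.
pose c : {sigma_finite_measure set nat -> \bar R} := @counting nat R.
rewrite -[LHS](@Rintegral12 _ _ _ nat R c m F iF).
rewrite -[RHS](@Rintegral12 _ _ _ nat R c m G iG).
exact: eq_RintegralT.
Qed.

Section box_real.
Context {R : realType} {n : nat}.
Variable mu : 'I_n.+1 -> {finite_measure set R -> \bar R}.
Let mu0 := mu ord0.
Let nu := box_measure (fun i => mu (lift ord0 i)).

Lemma integrable_box_prod (g : n.+1.-tuple R -> R) : measurable_fun setT g ->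
  (box_measure mu).-integrable setT (EFin \o g) ->
  (mu0 \x nu)%E.-integrable setT (fun z => (g (tuple_cons z))%:E).
Proof.
move=> mg /integrableP[_ ig].
have mgc : measurable_fun setT (fun z => g (tuple_cons z)).
  exact: measurableT_comp mg (@measurable_tuple_cons _ _ n).
apply/integrableP; split; first exact/measurable_EFinP.
rewrite ge0_integral_box_prod// in ig.
by apply: measurableT_comp => //; exact/measurable_EFinP.
Qed.

Lemma Rintegral_box_prod (g : n.+1.-tuple R -> R) : measurable_fun setT g ->
  (box_measure mu).-integrable setT (EFin \o g) ->
  \int[box_measure mu]_x g x = \int[(mu0 \x nu)%E]_z g (tuple_cons z).
Proof.
move=> mg ig; congr fine.
have mEg : measurable_fun setT (EFin \o g) by exact/measurable_EFinP.
have ig' : (mu0 \x nu)%E.-integrable (@tuple_cons R n @^-1` setT)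
    ((EFin \o g) \o @tuple_cons R n).
  by rewrite preimage_setT; exact: integrable_box_prod.
have := @integral_pushforward _ _ (R * n.-tuple R)%type _ R (@tuple_cons R n)
  (@measurable_tuple_cons _ _ n) (mu0 \x nu)%E setT _ mEg ig' measurableT.
by rewrite preimage_setT => <-.
Qed.

End box_real.

Section weak_pair.
Context {R : realType}.

Definition indep n (j : 'I_n) (w : n.-tuple R -> R) :=
  forall x x', (forall l, l != j -> tnth x l = tnth x' l) -> w x = w x'.

(* Testing against every square integrable w that does not involve the j-th
   coordinate says that almost every slice of f in the direction j has the
   corresponding slice of Df as derivative, tested on the pairs in T. *)
Definition weak_pair (T : (R -> R) -> (R -> R) -> Prop) n
    (mu : 'I_n -> {finite_measure set R -> \bar R}) (j : 'I_n)
    (f Df : n.-tuple R -> R) :=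
  forall u u', T u u' -> forall w, L2 (box_measure mu) w -> indep n j w ->
    \int[box_measure mu]_x (Df x * u (tnth x j) * w x) =
    \int[box_measure mu]_x (f x * u' (tnth x j) * w x).

(** Multiplication by [u] or [u'] then preserves square integrability, which makes every pairing
    below integrable. *)
Definition bounded_pairs (T : (R -> R) -> (R -> R) -> Prop) :=
  forall u u', T u u' -> [/\ measurable_fun setT u, measurable_fun setT u' &
    exists C, (forall x, `|u x| <= C) /\ (forall x, `|u' x| <= C)].

Lemma L2_mul_coord n (mu : 'I_n -> {finite_measure set R -> \bar R}) (j : 'I_n)
    (f : n.-tuple R -> R) (u : R -> R) C :
  measurable_fun setT u -> (forall x, `|u x| <= C) -> L2 (box_measure mu) f ->
  L2 (box_measure mu) (fun x => f x * u (tnth x j)).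
Proof.
move=> mu' uC hf; apply: (L2_mul_bounded _ _ _ C) => //.
exact: measurableT_comp mu' (measurable_tnth j).
Qed.

(** The core is $s^{-1}\int f\varphi\,dy$, so its derivative should be $s^{-1}\int Df\,\varphi\,dy$.
    This is [weak_pair] tested on $\varphi$ itself, which does not involve the first coordinate. *)
Lemma weak_pair_head T n (mu : 'I_n.+1 -> {finite_measure set R -> \bar R})
    (f Df : n.+1.-tuple R -> R) (phi : n.-tuple R -> R) (g : R -> R) (s : R) :
  bounded_pairs T ->
  L2 (box_measure mu) f -> L2 (box_measure mu) Df ->
  weak_pair T n.+1 mu ord0 f Df ->
  L2 (box_measure (fun i => mu (lift ord0 i))) phi ->
  \int[box_measure (fun i => mu (lift ord0 i))]_y (phi y * phi y) = 1 ->
  s != 0 -> L2 (mu ord0) g ->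
  ae_eq (mu ord0) setT (fun x => s * g x)
    (fun x => \int[box_measure (fun i => mu (lift ord0 i))]_y (f (tuple_cons (x, y)) * phi y)) ->
  exists Dg, L2 (mu ord0) Dg /\ forall u u', T u u' ->
    \int[mu ord0]_x (Dg x * u x) = \int[mu ord0]_x (g x * u' x).
Proof.
move=> bT hf hDf wp hphi phi1 s0 hg gE.
set nu := box_measure (fun i => _) in hphi phi1 gE *.
have [mf _] := hf; have [mDf _] := hDf; have [mphi _] := hphi; have [mg _] := hg.
have /(L2_boxP _ _ _ mf) hfc := hf; have /(L2_boxP _ _ _ mDf) hDfc := hDf.
pose w (x : n.+1.-tuple R) := phi (behead_tuple x).
have mw : measurable_fun setT w by exact: measurableT_comp mphi (measurable_behead _).
have hw : L2 (box_measure mu) w.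
  apply/L2_boxP => //.
  rewrite (_ : (fun z => w (tuple_cons z)) = (fun z => 1 * phi z.2)); last first.
    by apply/funext => -[x y]; rewrite /w behead_tuple_cons mul1r.
  apply: (L2_tensor _ _ (fun=> 1)) => //; split=> //.
  under eq_integral do rewrite expr1n.
  by rewrite integral_cst// mul1e -ge0_fin_numE// fin_num_measure.
have iw : indep n.+1 ord0 w.
  move=> x x' xx'; congr phi; apply: eq_from_tnth => i.
  have := xx' (lift ord0 i) isT.
  by rewrite !(tnth_nth 0)/= !nth_behead.
have key (k : n.+1.-tuple R -> R) (v : R -> R) C :
    measurable_fun setT v -> (forall x, `|v x| <= C) ->
    L2 (box_measure mu) k ->
    \int[box_measure mu]_x (k x * v (tnth x ord0) * w x) =
    \int[mu ord0]_x ((\int[nu]_y (k (tuple_cons (x, y)) * phi y)) * v x).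
  move=> mv vC hk; have [mk _] := hk.
  have hkv := L2_mul_coord _ mu ord0 k v C mv vC hk.
  have ikv := L2M hkv hw.
  have mkv : measurable_fun setT (fun x => k x * v (tnth x ord0) * w x).
    by apply/measurable_EFinP; exact: measurable_int ikv.
  rewrite (Rintegral_box_prod mu _ mkv ikv).
  have ikc := integrable_box_prod mu _ mkv ikv.
  rewrite -(Rintegral12 _ _ _ ikc).
  have /(L2_boxP _ _ _ mk) hkc := hk.
  have mkc : measurable_fun setT (fun z => k (tuple_cons z)) by case: hkc.
  apply: ae_eq_Rintegral.
  - by apply: (measurable_Rintegral1 nu (fun z => k (tuple_cons z) * v (tnth (tuple_cons z) ord0) * w (tuple_cons z))); exact: measurableT_comp mkv (@measurable_tuple_cons _ _ n).
  - apply: measurable_funM => //.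
    apply: (measurable_Rintegral1 nu (fun z => k (tuple_cons z) * phi z.2)).
    by apply: measurable_funM => //; exact: measurableT_comp mphi measurable_snd.
  (* [v x] can be moved across the inner integral only where the slice is integrable, which holds
     almost everywhere. *)
  have : {ae mu ord0, forall x, nu.-integrable setT (fun y => (k (tuple_cons (x, y)) * phi y)%:E)}.
    have ikw := L2M hk hw.
    have mkw : measurable_fun setT (fun x => k x * w x).
      by apply/measurable_EFinP; exact: measurable_int ikw.
    have := ae_integrable1 (integrable_box_prod mu _ mkw ikw).
    apply: filterS => x; apply: eq_integrable => // y _.
    by rewrite /w behead_tuple_cons.
  apply: filterS => x ix _.
  rewrite mulrC -RintegralZl//; apply: eq_RintegralT => y.
  by rewrite /w behead_tuple_cons tnth_tuple_cons0/= mulrAC mulrC.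
pose Dg x := s^-1 * \int[nu]_y (Df (tuple_cons (x, y)) * phi y).
have hDg0 := L2_kernel _ _ _ phi hDfc hphi phi1.
exists Dg; split; first exact: L2Z.
move=> u u' Tuu'; have [m1 m2 [C [uC u'C]]] := bT _ _ Tuu'.
have e := wp _ _ Tuu' w hw iw.
rewrite (key _ _ C)// in e; rewrite (key _ _ C)// in e.
have hu (v : R -> R) : measurable_fun setT v -> (forall x, `|v x| <= C) ->
    L2 (mu ord0) v.
  move=> mv vC; apply: (L2_le (fun=> C)) => //.
    by move=> x; rewrite (le_trans (vC x))// ler_norm.
  split=> //; rewrite integral_cst//.
  by rewrite lte_mul_pinfty// ?lee_fin ?sqr_ge0// -ge0_fin_numE// fin_num_measure.
rewrite (eq_RintegralT (fun x => s^-1 * ((\int[nu]_y (Df (tuple_cons (x, y)) * phi y)) * u x)));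
  last by move=> x; rewrite mulrA.
rewrite RintegralZl//; last by apply: L2M => //; exact: hu.
rewrite e -RintegralZl//; last first.
  exact: (L2M (L2_kernel _ _ _ phi hfc hphi phi1) (hu _ m2 u'C)).
apply: ae_eq_Rintegral.
- apply: measurable_funM => //; apply: measurable_funM => //.
  by case: (L2_kernel _ _ _ phi hfc hphi phi1).
- exact: measurable_funM.
- apply: filterS gE => x /(_ I) gx _.
  by rewrite -gx mulrA mulrA mulVf// mul1r.
Qed.

End weak_pair.

Section one_tuple.
Context {R : realType}.
Variable mu : 'I_1 -> {finite_measure set R -> \bar R}.

Lemma tuple_cons_nil (x : R) (y : 0.-tuple R) : tuple_cons (x, y) = [tuple x].
Proof. by apply: val_inj => /=; rewrite (tuple0 y). Qed.

Lemma measurable_tuple1 : measurable_fun setT (fun x : R => [tuple x]).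
Proof.
apply/measurable_fun_tnthP => i; rewrite (_ : _ \o _ = id) //.
by apply/funext => x /=; rewrite (ord1 i).
Qed.

Lemma ge0_integral_box1 (g : 1.-tuple R -> \bar R) :
  measurable_fun setT g -> (forall x, 0 <= g x)%E ->
  (\int[box_measure mu]_x g x = \int[mu ord0]_x g [tuple x])%E.
Proof.
move=> mg g0; rewrite ge0_integral_box//; apply: eq_integral => x _.
rewrite (eq_integral (cst (g [tuple x]))); last by move=> y _; rewrite tuple_cons_nil.
by rewrite integral_cst// [X in (_ * X)%E](_ : _ = 1%E) ?mule1//; exact: diracT.
Qed.

Lemma L2_box1 (g : 1.-tuple R -> R) : measurable_fun setT g ->
  L2 (box_measure mu) g <-> L2 (mu ord0) (fun x => g [tuple x]).
Proof.
move=> mg.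
have sq0 x : (0 <= (g x ^+ 2)%:E)%E by rewrite lee_fin sqr_ge0.
have h := ge0_integral_box1 _ (measurable_sqr _ mg) sq0.
split=> -[m fin]; split=> //; [|by rewrite -h|by rewrite h].
exact: measurableT_comp mg measurable_tuple1.
Qed.

Lemma Rintegral_box1 (g : 1.-tuple R -> R) : measurable_fun setT g ->
  (box_measure mu).-integrable setT (EFin \o g) ->
  \int[box_measure mu]_x g x = \int[mu ord0]_x g [tuple x].
Proof.
move=> mg ig; rewrite Rintegral_box_prod//.
rewrite -(Rintegral12 _ _ _ (integrable_box_prod mu _ mg ig)).
apply: eq_RintegralT => x.
rewrite (eq_RintegralT (cst (g [tuple x]))); last by move=> y; rewrite tuple_cons_nil.
rewrite Rintegral_cst// [X in fine X](_ : _ = 1%E) ?mulr1//; exact: diracT.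
Qed.

End one_tuple.

Section slices.
Context {R : realType}.

Lemma L2_counting_slice (m : {finite_measure set R -> \bar R}) (g : nat * R -> R) a :
  L2 (counting_product m) g -> L2 m (fun x => g (a, x)).
Proof.
move=> [mg hg]; split; first exact: measurable_slice1.
apply: le_lt_trans hg; rewrite ge0_integral_counting_prod; last 2 first.
- exact: measurable_sqr.
- by move=> z; rewrite lee_fin sqr_ge0.
apply: (nneseries_ge_term (fun a => \int[m]_x (g (a, x) ^+ 2)%:E)%E) => i.
by apply: integral_ge0 => x _; rewrite lee_fin sqr_ge0.
Qed.

Lemma L2_row_kernelP n (mu : 'I_n.+1 -> {finite_measure set R -> \bar R})
    (h : nat -> n.+1.-tuple R -> R) : (forall a, measurable_fun setT (h a)) ->
  L2 (counting_product (mu ord0) \x box_measure (fun i => mu (lift ord0 i)))%E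
    (row_kernel n h) <->
  (\sum_(a <oo) \int[box_measure mu]_x (h a x ^+ 2)%:E < +oo)%E.
Proof.
move=> mh; have mH := measurable_row_kernel _ h mh.
suff -> : (\sum_(a <oo) \int[box_measure mu]_x (h a x ^+ 2)%:E =
   \int[counting_product (mu ord0)]_z \int[box_measure (fun i => mu (lift ord0 i))]_y
     (row_kernel n h (z, y) ^+ 2)%:E)%E.
  by split=> [/L2_prodP[]//|hf]; apply/L2_prodP.
rewrite ge0_integral_counting_prod; last 2 first.
- apply: (measurable_fun_fubini_tonelli_F (fun w => (row_kernel n h w ^+ 2)%:E)).
    exact: measurable_sqr.
  by move=> z; rewrite lee_fin sqr_ge0.
- by move=> z; apply: integral_ge0 => y _; rewrite lee_fin sqr_ge0.
apply: eq_eseriesr => a _; rewrite ge0_integral_box//.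
- exact: measurable_sqr.
- by move=> x; rewrite lee_fin sqr_ge0.
Qed.

End slices.

(** * From the derivative of a kernel to that of the next kernel *)

Section tail.
Context {R : realType} {d : measure_display} {Z : measurableType d}.
Variable mz : {sigma_finite_measure set Z -> \bar R}.
Variables (n : nat) (mu : 'I_n -> {finite_measure set R -> \bar R}) (j : 'I_n).
Let nu := box_measure mu.
Variables (K DK : Z * n.-tuple R -> R) (lambda : nat -> R).
Variables (gamma : nat -> Z -> R) (phi : nat -> n.-tuple R -> R).
Hypothesis mK : measurable_fun setT K.
Hypothesis hS : Defs.schmidt mz nu K lambda gamma phi.
Hypothesis hDK : L2 (mz \x nu)%E DK.
Variable T : (R -> R) -> (R -> R) -> Prop.
Hypothesis bT : bounded_pairs T.
Hypothesis hpair : forall u u', T u u' -> forall g w, L2 mz g -> L2 nu w ->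
  indep n j w ->
  \int[(mz \x nu)%E]_z ((DK z * u (tnth z.2 j)) * (g z.1 * w z.2)) =
  \int[(mz \x nu)%E]_z ((K z * u' (tnth z.2 j)) * (g z.1 * w z.2)).

(** Since [Num.sqrt (lambda b) * phi b] is the integral of [K] against [gamma b], its derivative is
    that of [DK]. At zero weight the function to differentiate is 0, and [gamma b] lies outside the
    family known to be orthonormal, hence the value 0. *)
Definition next_derivative b y :=
  if lambda b != 0 then \int[mz]_z (DK (z, y) * gamma b z) else 0.

Let hK := schmidt_L2 _ _ _ _ _ _ mK hS.
Let hgamma b := schmidt_L2gamma _ _ _ _ _ _ hS b.
Let hphi b := schmidt_L2phi _ _ _ _ _ _ hS b.

Let measurable_contract (k : Z * n.-tuple R -> R) b : measurable_fun setT k ->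
  measurable_fun setT (fun y => \int[mz]_z (k (z, y) * gamma b z)).
Proof.
move=> mk.
apply: (measurable_Rintegral1 mz (fun w => k (w.2, w.1) * gamma b w.2)).
apply: measurable_funM.
  exact: (measurableT_comp mk (measurable_fun_pair measurable_snd measurable_fst)).
exact: (measurableT_comp (L2_measurable (hgamma b)) measurable_snd).
Qed.

Lemma measurable_next_derivative b : measurable_fun setT (next_derivative b).
Proof.
rewrite /next_derivative; case: (lambda b != 0); last exact: measurable_cst.
by apply: measurable_contract; case: hDK.
Qed.

(** For each y, Bessel's inequality in z bounds all partial sums by the integral of [DK (z, y) ^+ 2]
    over z, whose integral over y is finite. *)
Lemma next_derivative_summable :
  (\sum_(b <oo) \int[nu]_y (next_derivative b y ^+ 2)%:E < +oo)%E.
Proof.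
have /L2_prodP[mDK fDK] := hDK.
have i0 b : (0 <= \int[nu]_y (next_derivative b y ^+ 2)%:E)%E.
  by apply: integral_ge0 => y _; rewrite lee_fin sqr_ge0.
apply: le_lt_trans fDK; apply: lime_le; first exact: is_cvg_nneseries.
apply: nearW => N; rewrite integral_sqr_swap// big_mkord.
rewrite -ge0_integral_sum//; last 2 first.
- by move=> b; apply: measurable_sqr; exact: measurable_next_derivative.
- by move=> b y _; rewrite lee_fin sqr_ge0.
apply: ge0_le_integral => //.
- by move=> y _; apply: sume_ge0 => b _; rewrite lee_fin sqr_ge0.
- apply: emeasurable_sum => b.
  by apply: measurable_sqr; exact: measurable_next_derivative.
- apply: (measurable_fun_fubini_tonelli_G (fun z => (DK z ^+ 2)%:E)).
    exact: measurable_sqr.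
  by move=> z; rewrite lee_fin sqr_ge0.
move=> y _.
have [fy|] := ltP (\int[mz]_z (DK (z, y) ^+ 2)%:E)%E +oo%E; last first.
  by rewrite leye_eq => /eqP ->; exact: leey.
have hy : L2 mz (fun z => DK (z, y)) by split=> //; exact: measurable_slice2.
rewrite -L2_sqrE// sumEFin lee_fin.
apply: le_trans (bessel mz _ gamma (fun b => lambda b != 0) N hy _ _).
- rewrite [leRHS]big_mkcond; apply: ler_sum => b _; rewrite /next_derivative.
  by case: ifPn => // _; rewrite expr0n.
- by move=> i _; exact: hgamma.
- by move=> i i' ? ?; exact: schmidt_orthol hS _ _ _ _.
Qed.

Let contract_weak (k : Z * n.-tuple R -> R) b (v : R -> R) C (w : n.-tuple R -> R) :
  L2 (mz \x nu)%E k -> measurable_fun setT v -> (forall x, `|v x| <= C) ->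
  L2 nu w ->
  \int[nu]_y ((\int[mz]_z (k (z, y) * gamma b z)) * v (tnth y j) * w y) =
  \int[(mz \x nu)%E]_z ((k z * v (tnth z.2 j)) * (gamma b z.1 * w z.2)).
Proof.
move=> hk mv vC hw; have [mk _] := hk; have [mw _] := hw.
have mvj : measurable_fun setT (fun y : n.-tuple R => v (tnth y j)).
  exact: measurableT_comp mv (measurable_tnth j).
have hkv : L2 (mz \x nu)%E (fun z => k z * v (tnth z.2 j)).
  apply: (L2_mul_bounded _ _ _ C) => //.
  exact: (measurableT_comp mvj measurable_snd).
have ik := L2M hkv (L2_tensor _ _ _ _ (hgamma b) hw).
rewrite -(Rintegral21 _ _ _ ik); apply: ae_eq_Rintegral.
- by apply: measurable_funM => //; apply: measurable_funM => //; exact: measurable_contract.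
- apply: (measurable_Rintegral1 mz (fun y => k (y.2, y.1) * v (tnth y.1 j) * (gamma b y.2 * w y.1))).
  apply: (measurableT_comp (f := fun z => k z * v (tnth z.2 j) * (gamma b z.1 * w z.2)) _ (measurable_fun_pair measurable_snd measurable_fst)).
  by apply/measurable_EFinP; exact: measurable_int ik.
(* Tensoring [gamma b] with the constant 1 shows that [k (z, y) * gamma b z] is integrable in z for
   almost every y, as needed to take [v] and [w] into the inner integral. *)
have h1 : L2 nu (fun=> 1).
  split=> //; under eq_integral do rewrite expr1n.
  by rewrite integral_cst// mul1e -ge0_fin_numE// fin_num_measure.
have := ae_integrable2 (L2M hk (L2_tensor _ _ _ _ (hgamma b) h1)).
apply: filterS => y iy _.
have iy' : mz.-integrable setT (EFin \o (fun z => k (z, y) * gamma b z)).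
  by apply: eq_integrable iy => // z _ /=; rewrite mulr1.
rewrite -mulrA mulrC -RintegralZl//; apply: eq_RintegralT => z /=; ring.
Qed.

(** By Fubini's theorem this is [hpair] with [g] taken to be [gamma b]; [schmidt_right] then
    recognizes the contraction of [K]. *)
Lemma weak_pair_next b : weak_pair T n mu j
  (fun y => Num.sqrt (lambda b) * phi b y) (next_derivative b).
Proof.
move=> u u' Tuu' w hw iw; rewrite -/nu.
have [mu_ mu' [C [uC u'C]]] := bT _ _ Tuu'.
rewrite /next_derivative; have [l0|lb] := eqVneq (lambda b) 0.
  by apply: eq_RintegralT => y; rewrite l0 sqrtr0 !mul0r.
rewrite (contract_weak _ _ _ C)// (hpair _ _ Tuu')//.
rewrite -(contract_weak _ _ _ C)//.
have [mw _] := hw.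
have mvj : measurable_fun setT (fun y : n.-tuple R => u' (tnth y j)).
  exact: measurableT_comp mu' (measurable_tnth j).
apply: ae_eq_Rintegral.
- by apply: measurable_funM => //; apply: measurable_funM => //; exact: measurable_contract.
- apply: measurable_funM => //; apply: measurable_funM => //.
  by apply: measurable_funM => //; exact: L2_measurable (hphi b).
by apply: filterS (schmidt_right _ _ _ _ _ _ mK hS b lb) => y /(_ I) ->.
Qed.

End tail.

(** * Weak differentiability of the cores *)

Section cores.
Context {R : realType}.
Variable T : (R -> R) -> (R -> R) -> Prop.
Hypothesis bT : bounded_pairs T.

(** A product [g x * w y] is square integrable and ignores the coordinate [lift ord0 j], so it is a
    legitimate test; the conclusion has the shape of the hypothesis [hpair] of [weak_pair_next]. *)
Lemma weak_pair_tail n (mu : 'I_n.+1 -> {finite_measure set R -> \bar R}) j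
    (f Df : n.+1.-tuple R -> R) :
  L2 (box_measure mu) f -> L2 (box_measure mu) Df ->
  weak_pair T n.+1 mu (lift ord0 j) f Df ->
  forall u u', T u u' -> forall g w, L2 (mu ord0) g ->
  L2 (box_measure (fun i => mu (lift ord0 i))) w -> indep n j w ->
  \int[(mu ord0 \x box_measure (fun i => mu (lift ord0 i)))%E]_z
    ((Df (tuple_cons z) * u (tnth z.2 j)) * (g z.1 * w z.2)) =
  \int[(mu ord0 \x box_measure (fun i => mu (lift ord0 i)))%E]_z
    ((f (tuple_cons z) * u' (tnth z.2 j)) * (g z.1 * w z.2)).
Proof.
move=> hf hDf wp u u' Tuu' g w hg hw iw.
have [mu_ mu' [C [uC u'C]]] := bT _ _ Tuu'.
pose v (x : n.+1.-tuple R) := g (thead x) * w (behead_tuple x).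
have mv : measurable_fun setT v.
  apply: measurable_funM.
    exact: measurableT_comp (L2_measurable hg) (measurable_thead n).
  exact: measurableT_comp (L2_measurable hw) (measurable_behead n).
have hv : L2 (box_measure mu) v.
  apply/L2_boxP => //.
  rewrite (_ : (fun z => _) = (fun z => g z.1 * w z.2)); first exact: L2_tensor.
  by apply/funext => -[x y]; rewrite /v behead_tuple_cons.
have iv : indep n.+1 (lift ord0 j) v.
  move=> x x' xx'; rewrite /v; congr (g _ * _); first exact: xx'.
  apply: iw => l lj; have := xx' (lift ord0 l).
  rewrite (inj_eq lift_inj) => /(_ lj).
  by rewrite !(tnth_nth 0)/= !nth_behead.
have key k (c : R -> R) : L2 (box_measure mu) k -> measurable_fun setT c ->
    (forall x, `|c x| <= C) ->
  \int[(mu ord0 \x box_measure (fun i => mu (lift ord0 i)))%E]_z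
    ((k (tuple_cons z) * c (tnth z.2 j)) * (g z.1 * w z.2)) =
  \int[box_measure mu]_x (k x * c (tnth x (lift ord0 j)) * v x).
  move=> hk mc cC.
  have ik := L2M (L2_mul_coord _ _ (lift ord0 j) _ _ _ mc cC hk) hv.
  have mk : measurable_fun setT (fun x => k x * c (tnth x (lift ord0 j)) * v x).
    by apply/measurable_EFinP; exact: measurable_int ik.
  rewrite (Rintegral_box_prod mu _ mk ik); apply: eq_RintegralT => -[x y].
  by rewrite tnth_tuple_consS/= /v behead_tuple_cons.
by rewrite !key//; exact: wp.
Qed.

(** While [j] is not the first coordinate, the kernel and its derivative are contracted with the
    left singular functions; when it is, [weak_pair_head] applies to row [p]. Summability of [Dh]
    over the rows makes it a kernel for the counting measure; for [h] the same comes from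
    [schmidt_L2]. *)
Lemma ftt_from_core n (mu : 'I_n.+1 -> {finite_measure set R -> \bar R})
    (h Dh : nat -> n.+1.-tuple R -> R) lambda gamma (j : 'I_n.+1) :
  (forall a, L2 (box_measure mu) (h a)) ->
  (forall a, measurable_fun setT (Dh a)) ->
  (\sum_(a <oo) \int[box_measure mu]_x (Dh a x ^+ 2)%:E < +oo)%E ->
  (forall a, weak_pair T n.+1 mu j (h a) (Dh a)) ->
  ftt_from mu h lambda gamma ->
  forall p q, (j = ord_max -> q = 0%N) ->
  (forall i : 'I_n, i = j :> nat -> lambda i q != 0) ->
  L2 (mu j) (fun x => gamma j p x q) /\
  exists Dg, L2 (mu j) Dg /\ forall u u', T u u' ->
    \int[mu j]_x (Dg x * u x) = \int[mu j]_x (gamma j p x q * u' x).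
Proof.
have hDa m (nu : 'I_m.+1 -> {finite_measure set R -> \bar R})
      (k : nat -> m.+1.-tuple R -> R) :
    (forall a, measurable_fun setT (k a)) ->
    (\sum_(a <oo) \int[box_measure nu]_x (k a x ^+ 2)%:E < +oo)%E ->
    forall a, L2 (box_measure nu) (k a).
  move=> mk sk a; split=> //; apply: le_lt_trans sk.
  apply: (nneseries_ge_term (fun a => \int[box_measure nu]_x (k a x ^+ 2)%:E)%E) => i.
  by apply: integral_ge0 => x _; rewrite lee_fin sqr_ge0.
elim: n mu h Dh lambda gamma j => [|n ih] mu h Dh lambda gamma j hh mDh sDh wp.
  (* The last core is a row of the kernel, read at column 0, so the derivative of that row serves
     directly. *)
  move=> hE p q; rewrite (ord1 j) in wp * => /(_ (esym (ord1 _))) -> _.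
  have gE : (fun x => gamma ord0 p x 0%N) = (fun x => h p [tuple x]).
    by apply/funext => x; exact: hE.
  have mh := L2_measurable (hh p).
  split; first by rewrite gE; apply/L2_box1.
  have hD := hDa _ _ _ mDh sDh p.
  exists (fun x => Dh p [tuple x]); split; first by apply/L2_box1.
  move=> u u' Tuu'; have [mu_ mu' [C [uC u'C]]] := bT _ _ Tuu'.
  have h1 : L2 (box_measure mu) (fun=> 1).
    split=> //; under eq_integral do rewrite expr1n.
    by rewrite integral_cst// mul1e -ge0_fin_numE// fin_num_measure.
  have := wp p _ _ Tuu' (fun=> 1) h1 (fun _ _ _ => erefl).
  have key k (c : R -> R) : L2 (box_measure mu) k -> measurable_fun setT c ->
    (forall x, `|c x| <= C) ->
    \int[box_measure mu]_x (k x * c (tnth x ord0) * 1) = \int[mu ord0]_x (k [tuple x] * c x).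
    move=> hk mc cC.
    have ik := L2M (L2_mul_coord _ _ ord0 _ _ _ mc cC hk) h1.
    have mk : measurable_fun setT (fun x => k x * c (tnth x ord0) * 1).
      by apply/measurable_EFinP; exact: measurable_int ik.
    by rewrite (Rintegral_box1 mu _ mk ik); apply: eq_RintegralT => x; rewrite mulr1.
  rewrite !key// => ->; apply: eq_RintegralT => x.
  by rewrite -[gamma _ _ _ _]/((fun x => gamma ord0 p x 0%N) x) gE.
move=> [phi hS hft] p q jq lq.
have mh a := L2_measurable (hh a).
have mH := measurable_row_kernel _ h mh.
have hphi b := schmidt_L2phi _ _ _ _ _ _ hS b.
have hgamma b := schmidt_L2gamma _ _ _ _ _ _ hS b.
case: (unliftP ord0 j) wp jq lq => [j' ->|->] wp jq lq.
  have hDK : L2 (counting_product (mu ord0) \x box_measure (fun i => mu (lift ord0 i)))%E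
      (row_kernel _ Dh) by apply/L2_row_kernelP.
  have hK := schmidt_L2 _ _ _ _ _ _ mH hS.
  have hpair u u' : T u u' -> forall g w, L2 (counting_product (mu ord0)) g ->
      L2 (box_measure (fun i => mu (lift ord0 i))) w -> indep n.+1 j' w ->
      \int[(counting_product (mu ord0) \x box_measure (fun i => mu (lift ord0 i)))%E]_z
        ((row_kernel _ Dh z * u (tnth z.2 j')) * (g z.1 * w z.2)) =
      \int[(counting_product (mu ord0) \x box_measure (fun i => mu (lift ord0 i)))%E]_z
        ((row_kernel _ h z * u' (tnth z.2 j')) * (g z.1 * w z.2)).
    move=> Tuu' g w hg hw iw; have [mu_ mu' [C [uC u'C]]] := bT _ _ Tuu'.
    have intk k (c : R -> R) : L2 (counting_product (mu ord0) \x
          box_measure (fun i => mu (lift ord0 i)))%E k -> measurable_fun setT c ->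
        (forall x, `|c x| <= C) ->
        (counting_product (mu ord0) \x
          box_measure (fun i => mu (lift ord0 i)))%E.-integrable setT
          (EFin \o (fun z => (k z * c (tnth z.2 j')) * (g z.1 * w z.2))).
      move=> hk mc cC; apply: (L2M (f := fun z => k z * c (tnth z.2 j'))); last exact: L2_tensor.
      apply: (L2_mul_bounded _ _ _ C) => //.
      exact: (measurableT_comp (f := fun y => c (tnth y j'))
        (measurableT_comp mc (measurable_tnth j')) measurable_snd).
    have i1 := intk _ _ hDK mu_ uC; have i2 := intk _ _ hK mu' u'C.
    (* The test [g] involves the row index, but row [a] meets only its slice at [a], so the identity
       is checked row by row. *)
    rewrite -(Rintegral12 _ _ _ i1) -(Rintegral12 _ _ _ i2).
    apply: Rintegral_counting_prod_eq; [exact: (integrable_Rintegral1 _ _ _ i1)|exact: (integrable_Rintegral1 _ _ _ i2)|].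
    move=> a.
    have hga := L2_counting_slice _ _ a hg.
    have := weak_pair_tail _ _ j' _ _ (hh a) (hDa _ _ _ mDh sDh a) (wp a) _ _ Tuu' _ w hga hw iw.
    have intb k (c : R -> R) : L2 (box_measure mu) k -> measurable_fun setT c ->
        (forall x, `|c x| <= C) ->
        (mu ord0 \x box_measure (fun i => mu (lift ord0 i)))%E.-integrable setT
          (EFin \o (fun z => (k (tuple_cons z) * c (tnth z.2 j')) * (g (a, z.1) * w z.2))).
      move=> hk mc cC.
      apply: (L2M (f := fun z => k (tuple_cons z) * c (tnth z.2 j'))); last first.
        exact: (L2_tensor _ _ (fun x => g (a, x))).
      apply: (L2_mul_bounded _ _ _ C) => //; last by apply/L2_boxP => //; case: hk.
      exact: (measurableT_comp (f := fun y => c (tnth y j'))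
        (measurableT_comp mc (measurable_tnth j')) measurable_snd).
    rewrite -(Rintegral12 _ _ _ (intb _ _ (hDa _ _ _ mDh sDh a) mu_ uC)).
    by rewrite -(Rintegral12 _ _ _ (intb _ _ (hh a) mu' u'C)).
  apply: (ih (fun i => mu (lift ord0 i)) (fun b y => Num.sqrt (lambda ord0 b) * phi b y)
    (next_derivative (counting_product (mu ord0)) _ (row_kernel _ Dh) (lambda ord0) (fun b z => gamma ord0 z.1 z.2 b))
    (fun i => lambda (lift ord0 i)) (fun i => gamma (lift ord0 i)) j') => //.
  - by move=> b; apply: L2Z; exact: hphi.
  - by move=> b; exact: (measurable_next_derivative _ _ _ _ _ _ _ _ hS hDK).
  - exact: (next_derivative_summable _ _ _ _ _ _ _ _ hS hDK).
  - by move=> b; exact: (weak_pair_next _ _ _ _ _ _ _ _ _ mH hS hDK _ bT hpair).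
  - by move=> jm; apply: jq; apply: val_inj; rewrite /= jm.
  - by move=> i ij; apply: lq; rewrite /= ij.
have lq0 : lambda ord0 q != 0 by exact: lq.
have hg := L2_counting_slice _ _ p (hgamma q); split; first exact: hg.
have sq : Num.sqrt (lambda ord0 q) != 0 by rewrite (schmidt_s_neq0 _ _ _ _ _ _ hS).
apply: (weak_pair_head T _ mu (h p) (Dh p) (phi q) _ _ bT (hh p)
  (hDa _ _ _ mDh sDh p) (wp p) (hphi q) _ sq hg).
  by rewrite (schmidt_orthor hS) ?eqxx.
have m1 : measurable_fun setT (fun z : nat * R =>
    Num.sqrt (lambda ord0 q) * gamma ord0 z.1 z.2 q).
  by apply: measurable_funM => //; exact: L2_measurable (hgamma q).
have m2 : measurable_fun setT (fun z =>
    \int[box_measure (fun i => mu (lift ord0 i))]_y (row_kernel _ h (z, y) * phi q y)).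
  apply: (measurable_Rintegral1 _ (fun w => row_kernel _ h w * phi q w.2)).
  apply: measurable_funM => //.
  exact: (measurableT_comp (L2_measurable (hphi q)) measurable_snd).
exact: (ae_eq_counting_slice _ _ _ p m1 m2 (schmidt_left _ _ _ _ _ _ mH hS q lq0)).
Qed.

Lemma ftt_core n (mu : 'I_n.+2 -> {finite_measure set R -> \bar R})
    (f Df : n.+2.-tuple R -> R) lambda gamma (j : 'I_n.+2) :
  L2 (box_measure mu) f -> L2 (box_measure mu) Df ->
  weak_pair T n.+2 mu j f Df -> is_ftt mu f lambda gamma ->
  forall p q, (j = ord0 -> p = 0%N) -> (j = ord_max -> q = 0%N) ->
  (forall i : 'I_n.+1, i = j :> nat -> lambda i q != 0) ->
  L2 (mu j) (fun x => gamma j p x q) /\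
  exists Dg, L2 (mu j) Dg /\ forall u u', T u u' ->
    \int[mu j]_x (Dg x * u x) = \int[mu j]_x (gamma j p x q * u' x).
Proof.
move=> hf hDf wp [phi hS hft] p q jp jq lq.
have [mf _] := hf; have [mDf _] := hDf.
have mH : measurable_fun setT (fun z => f (tuple_cons z)).
  exact: measurableT_comp mf (@measurable_tuple_cons _ _ n.+1).
have hphi b := schmidt_L2phi _ _ _ _ _ _ hS b.
have hgamma b := schmidt_L2gamma _ _ _ _ _ _ hS b.
case: (unliftP ord0 j) wp jp jq lq => [j' ->|->] wp jp jq lq.
  have hDK : L2 (mu ord0 \x box_measure (fun i => mu (lift ord0 i)))%E
      (fun z => Df (tuple_cons z)) by apply/L2_boxP.
  have hpair := weak_pair_tail _ mu j' f Df hf hDf wp.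
  apply: (ftt_from_core _ (fun i => mu (lift ord0 i)) (fun b y => Num.sqrt (lambda ord0 b) * phi b y)
    (next_derivative (mu ord0) _ (fun z => Df (tuple_cons z)) (lambda ord0) (fun b x => gamma ord0 0%N x b))
    (fun i => lambda (lift ord0 i)) (fun i => gamma (lift ord0 i)) j') => //.
  - by move=> b; apply: L2Z; exact: hphi.
  - by move=> b; exact: (measurable_next_derivative _ _ _ _ _ _ _ _ hS hDK).
  - exact: (next_derivative_summable _ _ _ _ _ _ _ _ hS hDK).
  - by move=> b; exact: (weak_pair_next _ _ _ _ _ _ _ _ _ mH hS hDK _ bT hpair).
  - by move=> jm; apply: jq; apply: val_inj; rewrite /= jm.
  - by move=> i ij; apply: lq; rewrite /= ij.
have lq0 : lambda ord0 q != 0 by exact: lq.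
rewrite jp//; split; first exact: hgamma.
have sq : Num.sqrt (lambda ord0 q) != 0 by rewrite (schmidt_s_neq0 _ _ _ _ _ _ hS).
apply: (weak_pair_head T _ mu f Df (phi q) _ _ bT hf hDf wp (hphi q) _ sq (hgamma q)).
  by rewrite (schmidt_orthor hS) ?eqxx.
exact: (schmidt_left _ _ _ _ _ _ mH hS q lq0).
Qed.

End cores.

(** * Test functions *)

Section smooth1.
Context {R : realType}.

Lemma is_derive_comp1 (f g : R -> R) (x df dg : R) :
  is_derive x 1 f df -> is_derive (f x) 1 g dg ->
  is_derive x 1 (fun y => g (f y)) (dg * df).
Proof.
move=> [fx fd] [gx gd]; apply: DeriveDef.
  apply/derivable1_diffP.
  by apply: differentiable_comp; apply/derivable1_diffP.
by rewrite -derive1E (derive1_comp fx gx) !derive1E gd fd.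
Qed.

Lemma is_derive_quadratic0 (f : R -> R) (C : R) :
  f 0 = 0 -> (forall x, `|f x| <= C * x ^+ 2) -> is_derive (0 : R) 1 f 0.
Proof.
move=> f0 fC.
have C0 : 0 <= C.
  by have := fC 1; rewrite expr1n mulr1; apply: le_trans.
have lim : (fun h => h^-1 *: ((f \o shift 0) (h *: 1) - f 0)) @ (0 : R)^' --> (0 : R).
  apply/cvgrPdist_le => e e0.
  (* [C + 1] rather than [C], which may be 0. *)
  have d0 : 0 < e / (C + 1) by rewrite divr_gt0// ltr_wpDl.
  near=> h; rewrite sub0r normrN /= f0 subr0 addr0 [h *: 1]mulr1 [_ *: _]mulrC.
  have h0 : h != 0 by near: h; exact: nbhs_dnbhs_neq.
  rewrite normrM normfV ler_pdivrMr ?normr_gt0//.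
  apply: le_trans (fC h) _; rewrite -real_normK ?num_real// expr2 mulrA.
  rewrite ler_wpM2r//.
  have hd : `|h| <= e / (C + 1).
    near: h; apply: dnbhs0_le => //.
  rewrite (@le_trans _ _ ((C + 1) * `|h|))// ?ler_wpM2r// ?lerDl//.
  by rewrite mulrC -ler_pdivlMr// ltr_wpDl.
apply: DeriveDef; first by apply/cvg_ex; exists 0.
exact: (cvg_lim _ lim).
Unshelve. all: by end_near. Qed.

(** All powers of $1/x$ are allowed in front of $e^{-1/x}$ so that the family is closed under
    differentiation up to linear combinations. *)
Definition flat n (x : R) := if 0 < x then x ^- n * expR (- x^-1) else 0.

Lemma flat_ge0 n x : 0 <= flat n x.
Proof.
rewrite /flat; case: ifPn => // x0.
by rewrite mulr_ge0 ?expR_ge0// invr_ge0 exprn_ge0// ltW.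
Qed.

Lemma flat_gt0 n x : 0 < x -> 0 < flat n x.
Proof. by move=> x0; rewrite /flat x0 mulr_gt0 ?expR_gt0// invr_gt0 exprn_gt0. Qed.

(** From $e^y\ge y^{n+2}/(n+2)!$ at $y=1/x$. The exponent n + 2 leaves a factor $x^2$, which forces
    the derivative at 0 to exist and vanish. *)
Lemma flat_le n x : `|flat n x| <= (n.+2)`!%:R * x ^+ 2.
Proof.
rewrite ger0_norm ?flat_ge0// /flat; case: ifPn => x0; last first.
  by rewrite mulr_ge0// sqr_ge0.
have xV : 0 <= x^-1 by rewrite invr_ge0 ltW.
have := expR_ge1Dxn n.+1 xV; rewrite expRN => h.
have xn0 m : 0 < x ^+ m by exact: exprn_gt0.
have f0 : 0 < (n.+2)`!%:R :> R by rewrite ltr0n fact_gt0.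
have h2 : x^-1 ^+ n.+2 / (n.+2)`!%:R <= expR x^-1.
  by apply: le_trans h; rewrite lerDr.
have h3 : (expR x^-1)^-1 <= (n.+2)`!%:R * x ^+ n.+2.
  have hp : 0 < (n.+2)`!%:R * x ^+ n.+2 := mulr_gt0 f0 (xn0 _).
  rewrite -[leRHS]invrK lef_pV2 ?posrE ?expR_gt0 ?invr_gt0 ?hp//.
  by apply: le_trans h2; rewrite invfM mulrC exprVn.
apply: le_trans (ler_wpM2l _ h3) _; first by rewrite invr_ge0 ltW.
have xnN0 : x ^+ n != 0 by rewrite gt_eqF.
rewrite mulrCA ler_wpM2l ?ler0n// (_ : x ^- n * _ = x ^+ 2)//.
by rewrite -addn2 exprD mulrA mulVf// mul1r.
Qed.

Lemma is_derive_flat (n : nat) (x : R) :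
  is_derive x 1 (flat n) (- n%:R * flat n.+1 x + flat n.+2 x).
Proof.
have [x0|x0|x0] := ltgtP x 0.
- rewrite /flat !ltNge (ltW x0)/= mulr0 addr0.
  apply: (@near_eq_is_derive _ _ _ (cst 0)).
  near=> y; rewrite ltNge (_ : y <= 0)//; near: y.
  by apply: filterS (lt_nbhsl x0) => y /ltW.
- have xN0 : x != 0 by rewrite gt_eqF.
  have dV : is_derive x 1 (fun y : R => y^-1) (- x ^- 2).
    have := @is_deriveV R id x 1 1 xN0 (is_derive_id _ _).
    by rewrite /GRing.scale/= mulr1.
  have dE : is_derive x 1 (fun y : R => expR (- y^-1)) (expR (- x^-1) * x ^- 2).
    apply: is_derive_comp1.
    have := is_deriveN dV; rewrite opprK; exact.
  have dX : is_derive x 1 (fun y : R => y ^- n) (- n%:R * x ^- n.+1).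
    have := is_derive_comp1 _ _ _ _ _ dV (is_deriveX n (is_derive_id (x^-1) 1)).
    rewrite (_ : (fun y => _) = (fun y : R => y ^- n)); last first.
      by apply/funext => y; rewrite /= exprfctE exprVn.
    move=> h; apply: is_derive_eq h _.
    case: (n) => [|m]; first by rewrite !mul0r oppr0 scale0r !mul0r.
    by rewrite /GRing.scale/= mulr1 exprVn !mulNr mulrN -mulrA -invfM -exprD addn2.
  have nf : \near x, ((fun y : R => y ^- n) * (fun y => expR (- y^-1))) x = flat n x.
    near=> y; rewrite /flat (_ : 0 < y)//; near: y; exact: lt_nbhsr.
  apply: is_derive_eq (near_eq_is_derive nf (is_deriveM dX dE)) _.
  rewrite /flat x0 /GRing.scale/= addrC; congr (_ + _).
    by rewrite mulrCA; congr (_ * _); rewrite mulrC.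
  by rewrite mulrCA -invfM -exprD addn2 mulrC.
- rewrite x0 [X in is_derive _ _ _ X](_ : _ = 0); last first.
    by rewrite /flat ltxx mulr0 addr0.
  apply: (is_derive_quadratic0 _ (n.+2)`!%:R); first by rewrite /flat ltxx.
  exact: flat_le.
Unshelve. all: by end_near. Qed.

(* A class of smooth functions visibly stable under differentiation. *)
Inductive elementary : (R -> R) -> Prop :=
| elementary_cst c : elementary (fun=> c)
| elementary_flat n a : elementary (fun x => flat n (x - a))
| elementary_flatN n a : elementary (fun x => flat n (a - x))
| elementary_add u v : elementary u -> elementary v -> elementary (fun x => u x + v x)
| elementary_mul u v : elementary u -> elementary v -> elementary (fun x => u x * v x)
| elementary_exp u : elementary u -> elementary (fun x => expR (u x)).

Lemma elementary_is_derive v : elementary v ->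
  exists2 v', elementary v' & forall x : R, is_derive x 1 v (v' x).
Proof.
elim=> {v} [c|n a|n a|u v eu [u' eu' du] ev [v' ev' dv]|u v eu [u' eu' du] ev [v' ev' dv]|u eu [u' eu' du]].
- exists (fun=> 0); first exact: elementary_cst.
  by move=> x; exact: is_derive_cst.
- exists (fun x => (- n%:R) * flat n.+1 (x - a) + flat n.+2 (x - a)).
    apply: elementary_add; last exact: elementary_flat.
    apply: (elementary_mul (fun=> - n%:R)); first exact: elementary_cst.
    exact: elementary_flat.
  move=> x; have := is_derive_comp1 _ _ _ _ _ (is_derive_shift x 1 (- a)) (is_derive_flat n (x - a)).
  by rewrite mulr1.
- exists (fun x => - 1 * (- n%:R * flat n.+1 (a - x) + flat n.+2 (a - x))).
    apply: (elementary_mul (fun=> -1)); first exact: elementary_cst.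
    apply: elementary_add; last exact: elementary_flatN.
    apply: (elementary_mul (fun=> - n%:R)); first exact: elementary_cst.
    exact: elementary_flatN.
  move=> x.
  have d : is_derive x 1 (fun y : R => a - y) (-1).
    have := is_deriveB (is_derive_cst a x 1) (is_derive_id x 1).
    by rewrite sub0r.
  have := is_derive_comp1 _ _ _ _ _ d (is_derive_flat n (a - x)).
  by rewrite mulrC.
- exists (fun x => u' x + v' x); first exact: elementary_add.
  by move=> x; exact: is_deriveD.
- exists (fun x => u x * v' x + v x * u' x).
    by apply: elementary_add; exact: elementary_mul.
  by move=> x; exact: is_deriveM.
- exists (fun x => expR (u x) * u' x).
    by apply: elementary_mul => //; exact: elementary_exp.
  by move=> x; apply: is_derive_comp1.
Qed.

Definition smooth1 (g : R -> R) := forall i x, derivable (g^`(i))%classic x 1.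

Lemma elementary_smooth v : elementary v -> smooth1 v.
Proof.
move=> ev i; suff : elementary (v^`(i))%classic.
  by move=> /elementary_is_derive[v' _ dv] x; case: (dv x).
elim: i => [//|i ih]; rewrite derive1nS.
have [v' ev' dv] := elementary_is_derive _ ih.
suff -> : (v^`(i))^`()%classic = v' by [].
by apply/funext => x; rewrite derive1E; case: (dv x).
Qed.

Lemma elementary_sum m (F : nat -> R -> R) :
  (forall k, elementary (F k)) -> elementary (fun x => \sum_(k < m) F k x).
Proof.
move=> eF; elim: m => [|m ih].
  under eq_fun do rewrite big_ord0; exact: elementary_cst.
by under eq_fun do rewrite big_ord_recr/=; exact: elementary_add.
Qed.

(** [s m] adds up the first [m] bumps supported in rational segments inside [O], and [v m] is
    $1-e^{-m\,s_m}$. This lies in [0, 1] without any normalization, vanishes where [s m] does, hence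
    off a finite union of segments, and tends to 1 where some bump is positive, that is, on [O]. *)
Lemma open_bumps (O : set R) : open O -> exists v : nat -> R -> R,
  [/\ forall m, smooth1 (v m), forall m x, 0 <= v m x <= 1,
      forall m, exists K, [/\ compact K, K `<=` O & forall x, v m x != 0 -> K x] &
      forall x, v m x @[m --> \oo] --> (\1_O x : R)].
Proof.
move=> oO.
(* Codes of no pair of rationals get (0, 0); there, as for reversed endpoints, the product of the
   two flat functions is identically 0. *)
pose ab k : rat * rat := odflt (0, 0) (unpickle k).
pose itv k : set R := `[ratr (ab k).1, ratr (ab k).2]%classic.
pose beta k x := if `[< itv k `<=` O >] then
  flat 0 (x - ratr (ab k).1) * flat 0 (ratr (ab k).2 - x) else 0.
pose s m x := \sum_(k < m) beta k x.
have ebeta k : elementary (beta k).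
  rewrite /beta; case: asboolP => _; last exact: elementary_cst.
  by apply: elementary_mul; [exact: elementary_flat|exact: elementary_flatN].
have beta0 k x : 0 <= beta k x.
  by rewrite /beta; case: asboolP => // _; rewrite mulr_ge0// flat_ge0.
have betaK k x : beta k x != 0 -> itv k `<=` O /\ itv k x.
  rewrite /beta; case: asboolP => [kO|_]; last by rewrite eqxx.
  rewrite mulf_eq0 negb_or /flat; case: ifPn => [|_]; last by rewrite eqxx.
  case: ifPn => [|_]; last by rewrite eqxx andbF.
  rewrite !subr_gt0 => h1 h2 _; split=> //.
  by rewrite /itv/= in_itv/= !ltW.
have s0 m x : 0 <= s m x by apply: sumr_ge0 => k _.
have smono m1 m2 x : (m1 <= m2)%N -> s m1 x <= s m2 x.
  move=> m12; rewrite /s -!(big_mkord xpredT (fun k => beta k x)).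
  rewrite (big_cat_nat (leq0n m1) m12)//= lerDl.
  exact: sumr_ge0.
exists (fun m x => 1 - expR (- (m%:R * s m x))); split.
- move=> m; apply: elementary_smooth.
  apply: (elementary_add (fun=> 1) (fun x => - expR (- (m%:R * s m x)))).
    exact: elementary_cst.
  rewrite (_ : (fun x => _) = (fun x => -1 * expR ((- m%:R) * s m x))); last first.
    by apply/funext => x; rewrite mulN1r mulNr.
  apply: (elementary_mul (fun=> -1)); first exact: elementary_cst.
  apply: elementary_exp; apply: (elementary_mul (fun=> - m%:R)); first exact: elementary_cst.
  exact: elementary_sum.
- move=> m x; rewrite subr_ge0 lerBlDr lerDl expR_ge0 andbT.
  by rewrite expR_le1 oppr_le0 mulr_ge0.
- move=> m.
  exists (\big[setU/set0]_(k < m) (if `[< itv k `<=` O >] then itv k else set0)); split.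
  + apply: bigsetU_compact => k _; case: ifPn => _; [exact: segment_compact|exact: compact0].
  + rewrite -(bigcup_mkord m (fun k => if `[< itv k `<=` O >] then itv k else set0)).
    by move=> x [k _]; case: asboolP => // kO; exact: kO.
  + move=> x vx; have : s m x != 0.
      by apply: contra_neq vx => ->; rewrite mulr0 oppr0 expR0 subrr.
    rewrite -(bigcup_mkord m (fun k => if `[< itv k `<=` O >] then itv k else set0)) => sx.
    have [k km bk] : exists2 k, (k < m)%N & beta k x != 0.
      apply: contrapT => h; move: sx => /eqP; apply; apply: big1 => k _.
      by apply: contrapT => /eqP bk; apply: h; exists k.
    have [kO kx] := betaK _ _ bk; exists k => //=.
    by rewrite asboolT.
- move=> x; rewrite indicE; have [|] := boolP (x \in O); last first.
    move=> xO; have sx m : s m x = 0.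
      apply: big1 => k _; apply: contrapT => /eqP /betaK[kO kx].
      by move: xO => /negP; apply; rewrite inE; exact: kO.
    under eq_fun do rewrite sx mulr0 oppr0 expR0 subrr.
    exact: cvg_cst.
  rewrite inE => Ox.
  have [k bk] : exists k, 0 < beta k x.
    have /nbhs_ballP[e /= e0 eO] : nbhs x O by exact: open_nbhs_nbhs.
    have xe : x - e / 2 < x by rewrite ltrBlDr ltrDl divr_gt0.
    have xe' : x < x + e / 2 by rewrite ltrDl divr_gt0.
    have [q1 /[!inE]/= /itvP q1P] := rat_in_itvoo xe.
    have [q2 /[!inE]/= /itvP q2P] := rat_in_itvoo xe'.
    exists (pickle (q1, q2)); rewrite /beta /itv /ab pickleK/= asboolT.
      by rewrite mulr_gt0// flat_gt0// subr_gt0 ?q1P ?q2P.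
    move=> y /=; rewrite in_itv/= => /andP[y1 y2]; apply: eO.
    rewrite /ball/= ltr_norml.
    have a1 : x - e / 2 < ratr q1 by rewrite q1P.
    have a2 : ratr q2 < x + e / 2 by rewrite q2P.
    by apply/andP; split; lra.
  rewrite -[X in _ --> X]subr0; apply: cvgB; first exact: cvg_cst.
  apply: (@squeeze_cvgr _ _ _ _ (fun=> 0) (fun m => expR (- (m%:R * beta k x)))).
  + exists k.+1 => // m /= km; rewrite expR_ge0/= ler_expR lerN2 ler_wpM2l//.
    apply: le_trans (smono _ _ x km); rewrite /s big_ord_recr/= lerDr.
    exact: sumr_ge0.
  + exact: cvg_cst.
  + rewrite (_ : (fun m => _) = (fun m => expR (- beta k x) ^+ m)).
      apply: cvg_expr; rewrite ger0_norm ?expR_ge0// expR_lt1 oppr_lt0//.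
    by apply/funext => m; rewrite -mulrN expRM_natl.
Qed.

End smooth1.

(** * Tensor products of one-variable test functions *)

Section tensor.
Context {R : realType}.

(** The orders of differentiation are part of the form, which makes it closed under [partial]:
    differentiating only increments [k]. *)
Definition tensor n (G : 'I_n -> R -> R) (k : 'I_n -> nat) (x : 'rV[R]_n) : R :=
  \prod_l (G l)^`(k l)%classic (x 0 l).

Section fixed.
Variables (n : nat) (G : 'I_n -> R -> R).
Hypothesis sG : forall l, smooth1 (G l).

Lemma partial_tensor (j : 'I_n) k :
  partial j (tensor n G k) = tensor n G (fun l => (k l + (l == j))%N).
Proof.
apply/funext => x; rewrite /partial /derive.
pose g := (G j)^`(k j)%classic.
pose C := \prod_(l | l != j) (G l)^`(k l)%classic (x 0 l).
(* Along the j-th axis only the j-th factor varies, the others being gathered in [C]. *)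
have tE h : tensor n G k (h *: delta_mx 0 j + x) = g (h + x 0 j) * C.
  rewrite /tensor (bigD1 j)//= !mxE !eqxx mulr1; congr (_ * _).
  apply: eq_bigr => l lj; rewrite !mxE eqxx/=.
  by rewrite (negbTE lj) mulr0 add0r.
have dg := sG j (k j) (x 0 j).
have lim : (fun h => h^-1 *: ((tensor n G k \o shift x) (h *: delta_mx 0 j) - tensor n G k x))
    @ (0 : R)^' --> 'D_1 g (x 0 j) * C.
  rewrite (_ : (fun h => _) = (fun h => (h^-1 *: ((g \o shift (x 0 j)) (h *: 1) - g (x 0 j))) * C)).
    by apply: cvgM; [exact: dg|exact: cvg_cst].
  apply/funext => h /=; rewrite tE.
  have -> : tensor n G k x = g (x 0 j) * C by rewrite -[x in LHS](add0r) -(scale0r (delta_mx 0 j)) tE add0r.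
  by rewrite [h *: 1]mulr1 -mulrBl scalerAl.
rewrite (cvg_lim _ lim)// /tensor (bigD1 j)//= eqxx addn1; congr (_ * _).
  by rewrite derive1nS derive1E.
by apply: eq_bigr => l lj; rewrite (negbTE lj) addn0.
Qed.

Lemma differentiable_tensor k x : differentiable (tensor n G k) x.
Proof.
rewrite (_ : tensor n G k = \prod_(l < n) (fun x : 'rV[R]_n => (G l)^`(k l)%classic (x 0 l))).
  elim/big_ind : _ => [|u v du dv|l _].
  - exact: differentiable_cst.
  - exact: differentiableM.
  - apply: (@differentiable_comp _ _ _ _ (fun x : 'rV[R]_n => x 0 l)).
      exact: differentiable_coord.
    by apply/derivable1_diffP; exact: sG.
apply/funext => y; rewrite /tensor.
by elim/big_rec2 : _ => // l u v _ ->.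
Qed.

Lemma smooth_tensor : smooth (tensor n G (fun=> 0%N)).
Proof.
move=> s; suff [k ->] : exists k, foldr partial (tensor n G (fun=> 0%N)) s = tensor n G k.
  exact: differentiable_tensor.
elim: s => [|j s [k ih]] /=; first by exists (fun=> 0%N).
by exists (fun l => (k l + (l == j))%N); rewrite ih partial_tensor.
Qed.

Lemma iter_partial_tensor j r k :
  iter r (partial j) (tensor n G k) = tensor n G (fun l => (k l + (l == j) * r)%N).
Proof.
elim: r => [|r ih]; first by congr tensor; apply/funext => l; rewrite muln0 addn0.
rewrite iterS ih partial_tensor; congr tensor; apply/funext => l.
by rewrite mulnS addnAC addnA.
Qed.

Lemma multi_partial_tensor k :
  multi_partial k (tensor n G (fun=> 0%N)) = tensor n G k.
Proof.
(* Generalization from [enum 'I_n] to any duplicate-free list, for induction. *)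
suff h s : uniq s -> foldr (fun j => iter (k j) (partial j)) (tensor n G (fun=> 0%N)) s =
    tensor n G (fun l => ((l \in s) * k l)%N).
  rewrite /multi_partial h ?enum_uniq//; congr tensor.
  by apply/funext => l; rewrite mem_enum mul1n.
elim: s => [|j s ih] /=; first by move=> _; congr tensor; apply/funext.
move=> /andP[js us]; rewrite ih// iter_partial_tensor; congr tensor.
apply/funext => l; rewrite in_cons; case: eqVneq => [->|lj] /=.
  by rewrite (negbTE js).
by rewrite mul0n addn0.
Qed.

Lemma test_function_tensor (U K : 'I_n -> set R) :
  (forall l, compact (K l)) -> (forall l, K l `<=` U l) ->
  (forall l x, G l x != 0 -> K l x) ->
  test_function U (tensor n G (fun=> 0%N)).
Proof.
move=> cK KU GK; pose B := [set x : 'rV[R]_n | forall l, K l (x ord0 l)].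
have cB : compact B by exact: rV_compact.
have clB : closed B by apply: compact_closed => //; exact: norm_hausdorff.
have sB : closure [set x | tensor n G (fun=> 0%N) x != 0] `<=` B.
  rewrite closureE => x; apply; split=> // y /= ty l; apply: GK.
  by apply: contra_neq ty => Gl0; rewrite /tensor (bigD1 l)//= Gl0 mul0r.
split; first exact: smooth_tensor.
- by apply: subclosed_compact sB => //; exact: closed_closure.
- by move=> x /sB xB l; apply: KU; exact: xB.
Qed.

End fixed.

Section line.
Variable v : 'rV[R]_1 -> R.
Hypothesis sv : smooth v.
Let g (x : R) := v (const_mx x).

Lemma foldr_nseq_iter i : foldr partial v (nseq i ord0) = iter i (partial ord0) v.
Proof. by elim: i => //= i ->. Qed.

Lemma derive_line (w : 'rV[R]_1 -> R) (x : R) : differentiable w (const_mx x) ->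
  derivable (fun x : R => w (const_mx x)) x 1 /\
  (fun x : R => w (const_mx x))^`()%classic x = partial ord0 w (const_mx x).
Proof.
move=> /(@diff_derivable _ _ _ _ _ (delta_mx 0 0)) dw.
have E : (fun h : R => h^-1 *: ((w \o shift (const_mx x)) (h *: delta_mx 0 0) - w (const_mx x)))
   = (fun h => h^-1 *: (((fun x : R => w (const_mx x)) \o shift x) (h *: 1) - w (const_mx x))).
  apply/funext => h /=; congr (_ *: (w _ - _)).
  by apply/matrixP => i j; rewrite !mxE !ord1.
split; first by rewrite /derivable -E.
by rewrite derive1E /partial /derive -E.
Qed.

Lemma derive1n_line i :
  (g^`(i))%classic = (fun x => iter i (partial ord0) v (const_mx x)).
Proof.
elim: i => // i ih; rewrite derive1nS ih; apply/funext => x.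
by rewrite (derive_line _ x _).2//= -foldr_nseq_iter; exact: sv.
Qed.

Lemma smooth1_line : smooth1 g.
Proof.
move=> i x; rewrite derive1n_line.
by apply: (derive_line _ x _).1; rewrite -foldr_nseq_iter; exact: sv.
Qed.

End line.

Lemma smooth1_continuous (g : R -> R) i : smooth1 g -> continuous (g^`(i))%classic.
Proof.
move=> sg x; apply: differentiable_continuous; apply/derivable1_diffP; exact: sg.
Qed.

(** [K] is closed, so off [K] the function vanishes on a neighbourhood and so do its derivatives; on
    [K] a continuous function is bounded. *)
Lemma smooth1_bounded (g : R -> R) (K : set R) i : smooth1 g -> compact K ->
  (forall x, g x != 0 -> K x) ->
  exists C, forall x, `|(g^`(i))%classic x| <= C.
Proof.
move=> sg cK gK.
have gK' x : (g^`(i))%classic x != 0 -> K x.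
  elim: i x => [//|i ih] x; apply: contra_neqP => Kx.
  have oK : open (~` K).
    by apply: closed_openC; apply: compact_closed => //; exact: norm_hausdorff.
  rewrite derive1nS derive1E (@near_eq_derive _ _ _ _ (cst 0)) ?derive_cst//.
  have : nbhs x (~` K) by apply: open_nbhs_nbhs.
  apply: filterS => y Ky; apply/eqP; apply: contrapT => /negP /ih; exact: Ky.
have : compact ((g^`(i))%classic @` K).
  apply: continuous_compact => //; apply: continuous_subspaceT.
  exact: smooth1_continuous.
move=> /compact_bounded[M [_ hM]].
(* The bound [hM] is only available strictly above [M]; the 0 covers the points where the derivative
   vanishes. *)
exists (Num.max 0 (M + 1)) => x.
have [->|gx] := eqVneq ((g^`(i))%classic x) 0; first by rewrite normr0 le_max lexx.
rewrite le_max; apply/orP; right; apply: hM; first by rewrite ltrDl.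
by exists x => //; exact: gK'.
Qed.

End tensor.

(** * Approximation of functions independent of a coordinate *)

Section density.
Context {R : realType}.

Lemma dominated_Rintegral0 d (T : measurableType d) (mu : {measure set T -> \bar R})
    (g : nat -> T -> R) (f F : T -> R) :
  (forall m, measurable_fun setT (g m)) -> measurable_fun setT f ->
  mu.-integrable setT (EFin \o F) ->
  (forall m x, `|g m x| <= `|F x|) -> (forall x, g m x @[m --> \oo] --> f x) ->
  (forall m, \int[mu]_x g m x = 0) -> \int[mu]_x f x = 0.
Proof.
move=> mg mf iF gF gf g0.
have ig m : mu.-integrable setT (EFin \o g m).
  apply: le_integrable iF => //; first exact/measurable_EFinP.
  by move=> x _ /=; rewrite lee_fin.
have mEg m : measurable_fun setT (EFin \o g m) by exact/measurable_EFinP.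
have mEf : measurable_fun setT (EFin \o f) by exact/measurable_EFinP.
have Egf : {ae mu, forall x, setT x -> (EFin \o g m) x @[m --> \oo] --> (EFin \o f) x}.
  by apply: aeW => x _; apply: cvg_EFin; [exact: nearW|exact: gf].
have EgF : {ae mu, forall x m, setT x -> (`|(EFin \o g m) x| <= (abse \o (EFin \o F)) x)%E}.
  by apply: aeW => x m _ /=; rewrite lee_fin.
have [iff _ lim] := dominated_convergence measurableT mEg mEf Egf (integrable_abse iF) EgF.
have lim0 : (\int[mu]_x (g m x)%:E)%E @[m --> \oo] --> 0%E.
  rewrite (_ : (fun m => _) = cst 0%E); first exact: cvg_cst.
  by apply/funext => m; rewrite -EFin_Rintegral// g0.
apply: EFin_inj; rewrite EFin_Rintegral//.
exact: (cvg_unique _ lim lim0).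
Qed.

Lemma indic_sum_trivIset (T : Type) (A : (set T)^nat) m x : trivIset setT A ->
  \1_(\big[setU/set0]_(k < m) A k) x = \sum_(k < m) \1_(A k) x :> R.
Proof.
move=> tA; rewrite [LHS]indicE; case: (boolP (_ \in _)); rewrite ?inE ?notin_setE.
  rewrite -bigcup_mkord => -[k /= km Akx].
  rewrite (bigD1 (Ordinal km))//= indicE mem_set// big1 ?addr0// => i ik.
  rewrite indicE memNset// => Aix; move: ik => /eqP; apply; apply: val_inj => /=.
  by apply: (tA i k I I); exists x.
rewrite -bigcup_mkord => h; rewrite big1// => i _; rewrite indicE memNset// => Aix.
by apply: h; exists i => //=.
Qed.

Section box.
Variables (n : nat) (mu : 'I_n -> {finite_measure set R -> \bar R}) (j : 'I_n).

(** Composition with [forget] makes any function independent of the j-th coordinate and leaves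
    unchanged those that already are; 0 is an arbitrary base point. *)
Definition forget (x : n.-tuple R) : n.-tuple R :=
  mktuple (fun l => if l == j then 0 else tnth x l).

Lemma measurable_forget : measurable_fun setT forget.
Proof.
apply/measurable_fun_tnthP => i; rewrite (_ : _ \o _ = fun x => if i == j then 0 else tnth x i).
  by case: (i == j); [exact: measurable_cst|exact: measurable_tnth].
by apply/funext => x /=; rewrite tnth_mktuple.
Qed.

Lemma indep_forget w x : indep n j w -> w (forget x) = w x.
Proof. by move=> iw; apply: iw => l lj; rewrite tnth_mktuple (negbTE lj). Qed.

Definition open_boxes : set (set (n.-tuple R)) :=
  [set E | exists2 O : 'I_n -> set R, (forall l, open (O l)) &
     E = [set x | forall l, O l (tnth x l)]].

Lemma measurable_open_boxes :
  @measurable _ (n.-tuple R) = <<s open_boxes >>.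
Proof.
have mid : measurable_fun setT (idfun : g_sigma_algebraType open_boxes -> n.-tuple R).
  apply/measurable_fun_tnthP => i.
  apply: (measurability _ (RGenOpens.measurableE R)).
  move=> _ [_ [a [b ->] <-]]; rewrite setTI; apply: sub_sigma_algebra.
  (* The preimage of an interval under one coordinate is a box whose other sides are full. *)
  exists (fun l => if l == i then `]a, b[%classic else setT).
    by move=> l; case: ifPn => _; [exact: interval_open|exact: openT].
  apply/seteqP; split=> [x /= xi l|x /= /(_ i)]; last by rewrite eqxx.
  by case: eqP => // ->.
apply/seteqP; split.
  by move=> E mE; have := mid measurableT E mE; rewrite setTI preimage_id.
apply: smallest_sub; first exact: sigma_algebra_measurable.
move=> E [V oV ->].
rewrite (_ : [set _ | _] = \bigcap_(l in [set: 'I_n]) ((fun x => tnth x l) @^-1` V l)).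
  apply: fin_bigcap_measurable => // l _.
  rewrite -[X in measurable X]setTI; apply: measurable_tnth => //.
  exact: open_measurable.
by apply/seteqP; split=> [x xO l _|x xO l]; exact: xO.
Qed.

Lemma prod_indic (O : 'I_n -> set R) (P : pred 'I_n) (x : n.-tuple R) :
  \prod_(l | P l) (\1_(O l) (tnth x l) : R) =
  \1_[set x | forall l, P l -> O l (tnth x l)] x.
Proof.
rewrite [RHS]indicE; case: (boolP (_ \in _)); rewrite ?inE ?notin_setE /= => h.
  by apply: big1 => l Pl; rewrite indicE mem_set//; exact: h.
move: h => /existsNP[l /not_implyP[Pl Ol]].
by rewrite (bigD1 l)//= indicE memNset// mul0r.
Qed.

Variable F : n.-tuple R -> R.
Hypothesis iF : (box_measure mu).-integrable setT (EFin \o F).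
Hypothesis F0 : forall O : 'I_n -> set R, (forall l, open (O l)) ->
  \int[box_measure mu]_x (F x * \prod_(l | l != j) \1_(O l) (tnth x l)) = 0.

Let mF : measurable_fun setT F.
Proof. by apply/measurable_EFinP; exact: measurable_int iF. Qed.

Let iFM (c : n.-tuple R -> R) : measurable_fun setT c -> (forall x, `|c x| <= 1) ->
  (box_measure mu).-integrable setT (EFin \o (fun x => F x * c x)).
Proof.
move=> mc c1; apply: le_integrable iF => //.
  by apply/measurable_EFinP; exact: measurable_funM.
by move=> x _ /=; rewrite lee_fin normrM ler_piMr.
Qed.

Let mind E : measurable E -> measurable_fun setT (fun x => \1_E (forget x) : R).
Proof. by move=> mE; exact: measurableT_comp (measurable_indic mE) measurable_forget. Qed.

Let ind1 (T : Type) (E : set T) (x : T) : `|\1_E x : R| <= 1.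
Proof. by rewrite ger0_norm ?indic_ge0// indicE lern1 leq_b1. Qed.

(** Dynkin's theorem: open boxes are stable under intersection and generate. Complements are handled
    because [F] itself has integral 0, and disjoint unions by dominated convergence. *)
Lemma integral_indic_forget E : measurable E ->
  \int[box_measure mu]_x (F x * \1_E (forget x)) = 0.
Proof.
move=> mE.
have full : \int[box_measure mu]_x F x = 0.
  rewrite -(F0 (fun=> setT) (fun=> openT)); apply: eq_RintegralT => x.
  by rewrite big1 ?mulr1// => l _; rewrite indicT.
move: (mE); rewrite measurable_open_boxes; move: E mE => E0 _.
apply: (@dynkin_induction _ (n.-tuple R) open_boxes
  (fun E => \int[box_measure mu]_x (F x * \1_E (forget x)) = 0)).
- exact: measurable_open_boxes.
- move=> A B [V oV ->] [V' oV' ->]; exists (fun l => V l `&` V' l).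
    by move=> l; exact: openI.
  by apply/seteqP; split=> [x [xV xV'] l //|x h]; split=> l; have [] := h l.
- by under eq_Rintegral do rewrite indicT mulr1.
- move=> E [V oV ->].
  (* After [forget], the j-th side contributes the constant [\1_(V j) 0], and [F0] applies to the
     remaining factors. *)
  rewrite (eq_RintegralT (fun x => \1_(V j) 0 * (F x * \prod_(l | l != j) \1_(V l) (tnth x l)))).
    rewrite RintegralZl ?F0 ?mulr0//.
    rewrite (_ : _ \o _ = EFin \o (fun x => F x * \1_[set x | forall l, l != j -> V l (tnth x l)] x)).
      apply: iFM => //; apply: measurable_indic; rewrite measurable_open_boxes.
      apply: sub_sigma_algebra; exists (fun l => if l == j then setT else V l).
        by move=> l; case: ifPn => _; [exact: openT|exact: oV].
      apply/seteqP; split=> [x /= h l|x /= h l lj]; last by have := h l; rewrite (negbTE lj).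
      by case: eqVneq => // lj; exact: h.
    by apply/funext => x /=; rewrite prod_indic.
  move=> x; rewrite mulrCA; congr (_ * _).
  have -> : [set x | forall l, V l (tnth x l)] = [set x : n.-tuple R | forall l, xpredT l -> V l (tnth x l)].
    by apply/seteqP; split=> y Vy l; [move=> _|]; exact: Vy.
  rewrite -(prod_indic V xpredT) (bigD1 j)//= tnth_mktuple eqxx; congr (_ * _).
  by apply: eq_bigr => l lj; rewrite tnth_mktuple (negbTE lj).
- move=> S mS S0.
  rewrite (eq_RintegralT (fun x => F x - F x * \1_S (forget x))).
    by rewrite RintegralB// ?full ?S0 ?subrr//; apply: iFM => //; exact: mind.
  move=> x; rewrite -[X in X - _]mulr1 -mulrBr; congr (_ * _).
  by rewrite !indicE in_setC; case: (_ \in S); rewrite /= ?subrr ?subr0.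
- move=> A mA tA A0.
  apply: (dominated_Rintegral0 _ _ _
    (fun m x => F x * \1_(\big[setU/set0]_(k < m) A k) (forget x)) _ F) => //.
  + move=> m; apply: measurable_funM => //; apply: mind.
    by apply: bigsetU_measurable.
  + by apply: measurable_funM => //; apply: mind; exact: bigcup_measurable.
  + by move=> m x; rewrite normrM ler_piMr.
  + move=> x; apply: cvgM; first exact: cvg_cst.
    rewrite [X in _ --> X]indicE; case: (boolP (_ \in _)); rewrite ?inE ?notin_setE => hx.
      have [k _ kx] := hx; apply: cvg_near_cst.
      exists k.+1 => // m /= km; rewrite indicE mem_set// -bigcup_mkord.
      by exists k.
    rewrite (_ : (fun m => _) = cst 0); first exact: cvg_cst.
    apply/funext => m; rewrite indicE memNset// -bigcup_mkord => -[k _ kx].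
    by apply: hx; exists k.
  + move=> m.
    rewrite (eq_RintegralT (fun x => \sum_(k < m) F x * \1_(A k) (forget x))).
      by rewrite Rintegral_sum ?big1// => k _; apply: iFM => //; exact: mind.
    by move=> x; rewrite -mulr_sumr indic_sum_trivIset.
Qed.

Import HBNNSimple.

Let integral_forget_ge0 (w : n.-tuple R -> R) : measurable_fun setT w -> indep n j w ->
  (forall x, 0 <= w x) ->
  (box_measure mu).-integrable setT (EFin \o (fun x => F x * w x)) ->
  \int[box_measure mu]_x (F x * w x) = 0.
Proof.
move=> mw iw w0 iFw.
have mEw : measurable_fun setT (EFin \o w) by exact/measurable_EFinP.
pose g := nnsfun_approx measurableT mEw.
have gcvg x : g m x @[m --> \oo] --> w x.
  have := cvg_nnsfun_approx measurableT mEw (fun x _ => w0 x) (x := x) I.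
  by move=> /fine_cvgP[].
have gw m x : g m x <= w x.
  have nd : nondecreasing_seq (fun m => g m x).
    by move=> a b ab; exact/lefP/nd_nnsfun_approx.
  have cg : cvgn (fun m => g m x) by apply: cvgP (gcvg x).
  by have := nondecreasing_cvgn_le nd cg m; rewrite (cvg_lim _ (gcvg x)).
(* The simple approximations may depend on the j-th coordinate, hence [forget]; since [w] does not,
   they still converge to it and stay below it. *)
apply: (dominated_Rintegral0 _ _ _ (fun m x => F x * g m (forget x)) _ _ _ _ iFw).
- move=> m; apply: measurable_funM => //.
  by apply: measurableT_comp measurable_forget.
- exact: measurable_funM.
- move=> m x /=; rewrite !normrM ler_wpM2l// !ger0_norm//.
  by rewrite -(indep_forget w x iw).
- by move=> x; apply: cvgM; [exact: cvg_cst|rewrite -(indep_forget w x iw)].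
- move=> m.
  have [N [c gE]] : exists N (c : nat -> R), forall x,
      g m x = \sum_(i < N) c i * \1_(g m @^-1` [set c i]) x.
    by eexists; eexists (fun i => nth 0 _ i); move=> x; exact: fimfunEord.
  have ig i : (box_measure mu).-integrable setT
      (EFin \o (fun x => F x * \1_(g m @^-1` [set c i]) (forget x))).
    by apply: iFM => //; exact: mind.
  rewrite (eq_RintegralT (fun x => \sum_(i < N)
      c i * (F x * \1_(g m @^-1` [set c i]) (forget x)))).
    rewrite Rintegral_sum; last first.
      by move=> i _; exact: (integrableZl measurableT (c i) (ig i)).
    apply: big1 => i _; rewrite RintegralZl//.
    by rewrite integral_indic_forget ?mulr0.
  move=> x; rewrite gE mulr_sumr; apply: eq_bigr => i _.
  by rewrite mulrCA.
Qed.

Lemma integral_indep_eq0 (w : n.-tuple R -> R) : measurable_fun setT w -> indep n j w ->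
  (box_measure mu).-integrable setT (EFin \o (fun x => F x * w x)) ->
  \int[box_measure mu]_x (F x * w x) = 0.
Proof.
move=> mw iw iFw.
pose p x := Num.max (w x) 0; pose q x := Num.max (- w x) 0.
have pq x : w x = p x - q x.
  by rewrite /p /q; case: (leP (w x) 0) => h; case: (leP (- w x) 0) => h'; lra.
have mp : measurable_fun setT p by exact: measurable_maxr.
have mq : measurable_fun setT q.
  by apply: measurable_maxr => //; exact: measurable_funN.
have pw x : `|p x| <= `|w x|.
  rewrite /p; case: (leP (w x) 0) => h; first by rewrite normr0.
  by [].
have qw x : `|q x| <= `|w x|.
  rewrite /q; case: (leP (- w x) 0) => h; first by rewrite normr0.
  by rewrite normrN.
have iM (c : n.-tuple R -> R) : measurable_fun setT c -> (forall x, `|c x| <= `|w x|) ->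
    (box_measure mu).-integrable setT (EFin \o (fun x => F x * c x)).
  move=> mc cw; apply: le_integrable iFw => //.
    by apply/measurable_EFinP; exact: measurable_funM.
  by move=> x _ /=; rewrite lee_fin !normrM ler_wpM2l.
rewrite (eq_RintegralT (fun x => F x * p x - F x * q x)).
  rewrite RintegralB//; [|exact: iM|exact: iM].
  have ip : indep n j p by move=> x x' xx'; rewrite /p (iw x x').
  have iq : indep n j q by move=> x x' xx'; rewrite /q (iw x x').
  have p0 x : 0 <= p x by rewrite /p le_max lexx orbT.
  have q0 x : 0 <= q x by rewrite /q le_max lexx orbT.
  rewrite (integral_forget_ge0 p mp ip p0 (iM p mp pw)).
  by rewrite (integral_forget_ge0 q mq iq q0 (iM q mq qw)) subr0.
by move=> x; rewrite pq mulrBr.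
Qed.

End box.

End density.

(** * From weak derivatives to the cores *)

Section weak_derivative.
Context {R : realType}.

Lemma box_coord_null n (mu : 'I_n -> {finite_measure set R -> \bar R}) l (A : set R) :
  measurable A -> mu l A = 0%E ->
  box_measure mu ((fun x => tnth x l) @^-1` A) = 0%E.
Proof.
move=> mA; elim: n mu l => [|n ih] mu l; first by case: l.
have mE i : measurable ((fun x : n.-tuple R => tnth x i) @^-1` A).
  by rewrite -[X in measurable X]setTI; exact: measurable_tnth.
case: (unliftP ord0 l) => [i ->|->] A0;
  rewrite -[LHS]/((mu ord0 \x box_measure (fun i => mu (lift ord0 i)))%E
    (@tuple_cons R n @^-1` _)).
  rewrite (_ : _ @^-1` _ = setT `*` ((fun x : n.-tuple R => tnth x i) @^-1` A)).
    rewrite product_measure1E// [X in (_ * X)%E](_ : _ = 0%E) ?mule0//.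
    exact: ih (fun i => mu (lift ord0 i)) i A0.
  by apply/seteqP; split=> -[x y] /=; rewrite tnth_tuple_consS//= => -[].
rewrite (_ : _ @^-1` _ = A `*` setT).
  by rewrite product_measure1E// [X in (X * _)%E](_ : _ = 0%E) ?mul0e.
by apply/seteqP; split=> -[x y] /=; rewrite tnth_tuple_cons0//= => -[].
Qed.

Lemma box_ae_coord n (mu : 'I_n -> {finite_measure set R -> \bar R})
    (U : 'I_n -> set R) :
  (forall l, measurable (U l)) -> (forall l, mu l (~` U l) = 0%E) ->
  {ae box_measure mu, forall x, forall l, U l (tnth x l)}.
Proof.
move=> mU U0; apply: filter_forall => l.
exists ((fun x => tnth x l) @^-1` (~` U l)); split=> //.
  rewrite -[X in measurable X]setTI; apply: measurable_tnth => //.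
  exact: measurableC.
by apply: box_coord_null; [exact: measurableC|exact: U0].
Qed.

Lemma multi_partial1 r (v : 'rV[R]_1 -> R) :
  multi_partial (fun _ : 'I_1 => r) v = iter r (partial ord0) v.
Proof.
rewrite /multi_partial enum_ordSl (_ : enum 'I_0 = [::])//.
by apply: size0nil; rewrite size_enum_ord.
Qed.

Lemma test_function_line (U : set R) (v : 'rV[R]_1 -> R) :
  test_function (fun _ : 'I_1 => U) v ->
  smooth1 (fun x : R => v (const_mx x)) /\
  exists K : set R, [/\ compact K, K `<=` U & forall x, v (const_mx x) != 0 -> K x].
Proof.
move=> [sv cS SU]; split; first exact: smooth1_line.
set S := closure _ in cS SU.
exists ((fun x : 'rV[R]_1 => x 0 0) @` S); split.
- apply: continuous_compact => //; apply: continuous_subspaceT => x.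
  exact: coord_continuous.
- by move=> _ [x Sx <-]; exact: SU.
- move=> x vx; exists (const_mx x); last by rewrite mxE.
  exact: subset_closure.
Qed.

(* The sign of the weak derivative is attached to the first function. *)
Definition test_pairs (U : set R) (r : nat) (u u' : R -> R) :=
  exists2 v : 'rV[R]_1 -> R, test_function (fun _ : 'I_1 => U) v &
    u = (fun x => (-1) ^+ r * v (const_mx x)) /\
    u' = (fun x => multi_partial (fun _ : 'I_1 => r) v (const_mx x)).

Lemma bounded_test_pairs U r : bounded_pairs (test_pairs U r).
Proof.
move=> u u' [v tv [-> ->]].
have [sg [K [cK KU gK]]] := test_function_line _ _ tv.
have [sv _ _] := tv.
have u'E : (fun x => multi_partial (fun _ : 'I_1 => r) v (const_mx x)) =
    ((fun x : R => v (const_mx x))^`(r))%classic.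
  by rewrite multi_partial1 derive1n_line.
have u'x x : multi_partial (fun _ : 'I_1 => r) v (const_mx x) =
    ((fun x : R => v (const_mx x))^`(r))%classic x.
  by rewrite -u'E.
have [C0 hC0] := smooth1_bounded _ _ 0 sg cK gK.
have [C1 hC1] := smooth1_bounded _ _ r sg cK gK.
rewrite u'E; split.
- apply: measurable_funM => //; apply: continuous_measurable_fun.
  exact: (smooth1_continuous _ 0 sg).
- by apply: continuous_measurable_fun; exact: smooth1_continuous.
- exists (Num.max C0 C1); split=> x.
    by rewrite normrM normrX normrN1 expr1n mul1r le_max hC0.
  by rewrite ?u'x le_max hC1 orbT.
Qed.

Lemma cvg_prod_ord (I : finType) (P : pred I) (u : I -> nat -> R) (l : I -> R) :
  (forall i, u i m @[m --> \oo] --> l i) ->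
  \prod_(i | P i) u i m @[m --> \oo] --> \prod_(i | P i) l i.
Proof.
move=> h; elim: (index_enum I) => [|i s ih].
  rewrite big_nil; under eq_fun do rewrite big_nil; exact: cvg_cst.
rewrite big_cons; case: ifPn => Pi; under eq_fun do rewrite big_cons.
  by rewrite Pi; apply: cvgM.
by rewrite (negbTE Pi).
Qed.

(** The one-variable test function in x_j times bumps in the other coordinates is an admissible test
    for [weak_derivative]. Letting the bumps tend to indicators gives the identity on open boxes,
    and [integral_indep_eq0] extends it to every [w]. *)
Lemma weak_pair_of_weak_derivative n (mu : 'I_n -> {finite_measure set R -> \bar R})
    (U : 'I_n -> set R) (j : 'I_n) (r : nat) (f Df : n.-tuple R -> R) :
  (forall l, open (U l)) -> (forall l, mu l (~` U l) = 0%E) ->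
  L2 (box_measure mu) f -> L2 (box_measure mu) Df ->
  weak_derivative U mu (fun l => (l == j) * r)%N f Df ->
  weak_pair (test_pairs (U j) r) n mu j f Df.
Proof.
move=> oU U0 hf hDf wd u u' Tuu' w hw iw.
have [mu_ mu' [C [uC u'C]]] := bounded_test_pairs _ _ _ _ Tuu'.
have [v tv [uE u'E]] := Tuu'.
have [sg [K [cK KU gK]]] := test_function_line _ _ tv.
set g := (fun x : R => v (const_mx x)) in sg gK.
have u'g : u' = (g^`(r))%classic.
  by have [sv _ _] := tv; rewrite u'E multi_partial1 derive1n_line.
have h1 := L2_mul_coord _ mu j _ _ C mu_ uC hDf.
have h2 := L2_mul_coord _ mu j _ _ C mu' u'C hf.
pose F x := Df x * u (tnth x j) - f x * u' (tnth x j).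
have hF : L2 (box_measure mu) F by exact: L2B.
have [mF _] := hF.
have one : L2 (box_measure mu) (fun=> 1).
  split=> //; under eq_integral do rewrite expr1n.
  by rewrite integral_cst// mul1e -ge0_fin_numE// fin_num_measure.
have iF : (box_measure mu).-integrable setT (EFin \o F).
  by have := L2M hF one; under eq_fun do rewrite mulr1.
suff F0 : forall O : 'I_n -> set R, (forall l, open (O l)) ->
    \int[box_measure mu]_x (F x * \prod_(l | l != j) \1_(O l) (tnth x l)) = 0.
  have := integral_indep_eq0 _ mu j F iF F0 w (L2_measurable hw) iw (L2M hF hw).
  rewrite (eq_RintegralT (fun x => Df x * u (tnth x j) * w x - f x * u' (tnth x j) * w x));
    last by move=> x; rewrite mulrBl.
  rewrite RintegralB//; [|exact: L2M|exact: L2M].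
  by move=> /eqP; rewrite subr_eq0 => /eqP.
move=> V oV.
(* The bumps must be supported in [U l], so they approximate the indicator of the smaller set; as
   [U l] has full measure, the integral is the same. *)
have [bump hb] := choice (fun l => open_bumps (V l `&` U l) (openI (oV l) (oU l))).
have mcoord (c : 'I_n -> R -> R) : (forall l, measurable_fun setT (c l)) ->
    measurable_fun setT (fun x : n.-tuple R => \prod_(l | l != j) c l (tnth x l)).
  move=> mc; elim: (index_enum _) => [|l s ih].
    by under eq_fun do rewrite big_nil; exact: measurable_cst.
  case: (boolP (l != j)) => lj; under eq_fun do rewrite big_cons.
    under eq_fun do rewrite lj; apply: measurable_funM => //.
    exact: measurableT_comp (mc l) (measurable_tnth l).
  by under eq_fun do rewrite (negbTE lj).
have prod01 (c : 'I_n -> R) : (forall l, 0 <= c l <= 1) ->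
    `|\prod_(l | l != j) c l| <= 1.
  move=> c01; rewrite normr_prod; apply: prodr_ile1 => l _.
  by have /andP[c0 c1] := c01 l; rewrite normr_ge0/= ger0_norm.
have mbump m l : measurable_fun setT (bump l m).
  apply: continuous_measurable_fun; have [sb _ _ _] := hb l.
  exact: (smooth1_continuous _ 0 (sb m)).
have mind (A : 'I_n -> set R) : (forall l, open (A l)) ->
    measurable_fun setT (fun x : n.-tuple R => F x * \prod_(l | l != j) \1_(A l) (tnth x l)).
  move=> oA; apply: measurable_funM => //.
  apply: (mcoord (fun l => (\1_(A l) : R -> R))) => l.
  by apply: measurable_indic; apply: open_measurable; exact: oA.
transitivity (\int[box_measure mu]_x
    (F x * \prod_(l | l != j) \1_(V l `&` U l) (tnth x l))).
  apply: ae_eq_Rintegral.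
  - exact: mind.
  - by apply: mind => l; exact: openI.
  apply: filterS (box_ae_coord _ mu U (fun l => open_measurable (oU l)) U0) => x Ux _.
  congr (_ * _); apply: eq_bigr => l _; rewrite !indicE in_setI.
  by rewrite [X in _ && X]mem_set ?andbT//; exact: Ux.
apply: (dominated_Rintegral0 _ _ _
  (fun m x => F x * \prod_(l | l != j) bump l m (tnth x l)) _ F) => //.
- by move=> m; apply: measurable_funM => //; apply: (mcoord (fun l => bump l m)) => l; exact: mbump.
- by apply: mind => l; exact: openI.
- move=> m x; rewrite normrM ler_piMr//; apply: prod01 => l.
  by have [_ b01 _ _] := hb l.
- move=> x; apply: cvgM; first exact: cvg_cst.
  by apply: cvg_prod_ord => l; have [_ _ _ bc] := hb l; exact: bc.
move=> m.
pose G l := if l == j then g else bump l m.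
have sG l : smooth1 (G l).
  by rewrite /G; case: ifPn => // _; have [sb _ _ _] := hb l.
have hK l : exists KL : set R, [/\ compact KL, KL `<=` U l & forall x, G l x != 0 -> KL x].
  rewrite /G; case: eqVneq => [->|_]; first by exists K.
  have [_ _ bK _] := hb l; have [KL [cKL KLU bKL]] := bK m.
  by exists KL; split=> // x /KLU[].
have [KL hKL] := choice hK.
have tG : test_function U (tensor n G (fun=> 0%N)).
  by apply: (test_function_tensor _ _ sG U KL) => l; have [] := hKL l.
have := wd _ tG; rewrite multi_partial_tensor//.
have -> : (\sum_l (l == j) * r)%N = r.
  by rewrite (bigD1 j)//= eqxx mul1n big1 ?addn0// => l lj; rewrite (negbTE lj).
pose P x := \prod_(l | l != j) bump l m (tnth x l).
have tE k (x : n.-tuple R) : (forall l, l != j -> k l = 0%N) ->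
    tensor n G k (row_of x) = (g^`(k j))%classic (tnth x j) * P x.
  move=> k0; rewrite /tensor (bigD1 j)//= mxE /G eqxx; congr (_ * _).
  by apply: eq_bigr => l lj; rewrite mxE k0// (negbTE lj).
have mP : measurable_fun setT P by apply: (mcoord (fun l => bump l m)) => l; exact: mbump.
have hP : L2 (box_measure mu) P.
  apply: (L2_le (fun=> 1)) => // x; rewrite normr1; apply: prod01 => l.
  by have [_ b01 _ _] := hb l.
move=> e.
rewrite (eq_RintegralT (fun x => Df x * u (tnth x j) * P x - f x * u' (tnth x j) * P x));
  last by move=> x; rewrite mulrBl.
rewrite RintegralB//; [|exact: L2M|exact: L2M].
apply/eqP; rewrite subr_eq0; apply/eqP.
(* The multi-index is concentrated on [j], so all r derivatives fall on [g] and none on the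
   bumps. *)
rewrite [RHS](eq_RintegralT (fun x => f x * tensor n G (fun l => (l == j) * r)%N (row_of x))); last first.
  move=> x; rewrite tE; last by move=> l lj; rewrite (negbTE lj).
  by rewrite eqxx mul1n u'g mulrA.
rewrite -e -RintegralZl//.
  apply: eq_RintegralT => x; rewrite tE// uE derive1n0 /g; ring.
have hg := L2_mul_coord _ mu j Df g.
have [C0 hC0] := smooth1_bounded _ _ 0 sg cK gK.
have mg : measurable_fun setT g.
  by apply: continuous_measurable_fun; exact: (smooth1_continuous _ 0 sg).
have := L2M (hg C0 mg hC0 hDf) hP.
by apply: eq_integrable => // x _ /=; rewrite tE//= mulrA.
Qed.

(** For each r up to k, the multi-index [idx r] selects the pure derivative of order r in direction
    [j], and [ftt_core] is applied to it with the test pairs of that order. *)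
Lemma sobolev_core n (mu : 'I_n.+2 -> {finite_measure set R -> \bar R})
    (U : 'I_n.+2 -> set R) (f : n.+2.-tuple R -> R) (k : nat) lambda gamma :
  (forall l, open (U l)) -> (forall l, mu l (~` U l) = 0%E) ->
  sobolev U mu k f -> is_ftt mu f lambda gamma ->
  forall (j : 'I_n.+2) (p q : nat),
  (j = ord0 -> p = 0%N) -> (j = ord_max -> q = 0%N) ->
  (forall i : 'I_n.+1, i = j :> nat -> lambda i q != 0) ->
  sobolev (fun _ : 'I_1 => U j) (fun _ : 'I_1 => mu j) k
    (fun x => gamma j p (thead x) q).
Proof.
move=> oU U0 [/Lfun2P hf [D [hD fin]]] hftt j p q jp jq lq.
pose idx (r : 'I_k.+1) : {ffun 'I_n.+2 -> 'I_k.+1} :=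
  [ffun l => if l == j then r else ord0].
have idxE r l : idx r l = ((l == j) * r)%N :> nat.
  by rewrite ffunE; case: (l == j); rewrite ?mul1n ?mul0n.
have idxS r : (\sum_l idx r l)%N = r.
  rewrite (bigD1 j)//= idxE eqxx mul1n big1 ?addn0// => l lj.
  by rewrite idxE (negbTE lj).
have idxk r : (\sum_l idx r l <= k)%N by rewrite idxS -ltnS.
have hDr r : L2 (box_measure mu) (D (idx r)).
  have [mD _] := hD _ (idxk r); split=> //; apply/Lnorm2_lty.
  apply: le_lt_trans fin; rewrite (bigD1 (idx r)) ?idxk//= leeDl//.
  by apply: sume_ge0 => i _; exact: Lnorm_ge0.
have wp (r : 'I_k.+1) : weak_pair (test_pairs (U j) r) n.+2 mu j f (D (idx r)).
  have [_ wd] := hD _ (idxk r); apply: weak_pair_of_weak_derivative => //.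
  rewrite (_ : (fun l => _) = (fun l : 'I_n.+2 => (idx r l : nat)))//.
  by apply/funext => l; rewrite idxE.
have core (r : 'I_k.+1) := ftt_core _ (bounded_test_pairs (U j) r) _ mu f (D (idx r)) lambda gamma j
  hf (hDr r) (wp r) hftt p q jp jq lq.
(* Square integrability of the core is common to all orders; order 0 always exists. *)
have [hg _] := core ord0.
have mg : measurable_fun setT (fun x : 1.-tuple R => gamma j p (thead x) q).
  by case: hg => + _ => /measurableT_comp; apply; exact: measurable_thead.
have [Dg hDg] := choice (fun r => (core r).2).
have mDg r : measurable_fun setT (fun x : 1.-tuple R => Dg r (thead x)).
  by case: (hDg r) => -[+ _] _ => /measurableT_comp; apply; exact: measurable_thead.
have hDg1 r : L2 (box_measure (fun _ : 'I_1 => mu j)) (fun x => Dg r (thead x)).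
  by apply/L2_box1 => //; case: (hDg r).
have hg1 : L2 (box_measure (fun _ : 'I_1 => mu j)) (fun x => gamma j p (thead x) q).
  by apply/L2_box1.
split; first exact/Lfun2P.
exists (fun i x => Dg (i ord0) (thead x)); split; last first.
  apply: lte_sum_pinfty => i _; apply/Lnorm2_lty.
  by case: (hDg1 (i ord0)).
move=> i _; split; first exact: mDg.
move=> v tv; set r := i ord0.
have -> : (\sum_l i l)%N = r by rewrite big_ord1.
have -> : (fun l : 'I_1 => (i l : nat)) = (fun _ : 'I_1 => r : nat).
  by apply/funext => l; rewrite (ord1 l).
pose u x := (-1) ^+ r * v (const_mx x).
pose u' x := multi_partial (fun _ : 'I_1 => r : nat) v (const_mx x).
have Tuu' : test_pairs (U j) r u u' by exists v.
have [mu_ mu' [C [uC u'C]]] := bounded_test_pairs _ _ _ _ Tuu'.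
have rowE (x : 1.-tuple R) : row_of x = const_mx (tnth x ord0).
  by apply/rowP => l; rewrite !mxE (ord1 l).
have key (h : R -> R) (c : R -> R) :
    L2 (box_measure (fun _ : 'I_1 => mu j)) (fun x => h (thead x)) ->
    measurable_fun setT c -> (forall x, `|c x| <= C) ->
    (box_measure (fun _ : 'I_1 => mu j)).-integrable setT
      (EFin \o (fun x => h (thead x) * c (tnth x ord0))) /\
    \int[box_measure (fun _ : 'I_1 => mu j)]_x (h (thead x) * c (tnth x ord0)) =
    \int[mu j]_x (h x * c x).
  move=> hh mc cC.
  have one : L2 (box_measure (fun _ : 'I_1 => mu j)) (fun=> 1).
    split=> //; under eq_integral do rewrite expr1n.
    by rewrite integral_cst// mul1e -ge0_fin_numE// fin_num_measure.
  have hc := L2_mul_coord _ _ ord0 _ _ _ mc cC hh.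
  have ic : (box_measure (fun _ : 'I_1 => mu j)).-integrable setT
      (EFin \o (fun x => h (thead x) * c (tnth x ord0))).
    by apply: eq_integrable (L2M hc one) => // x _ /=; rewrite mulr1.
  split=> //; rewrite Rintegral_box1//; exact: L2_measurable hc.
have [ig eg] := key (fun x => gamma j p x q) u' hg1 mu' u'C.
have [iD eD] := key (Dg r) u (hDg1 r) mu_ uC.
rewrite [RHS](eq_RintegralT (fun x => gamma j p (thead x) q * u' (tnth x ord0)));
  last by move=> x; rewrite rowE.
rewrite eg -((hDg r).2 _ _ Tuu') -eD.
have -> : \int[box_measure (fun _ : 'I_1 => mu j)]_x (Dg r (thead x) * u (tnth x ord0)) =
   \int[box_measure (fun _ : 'I_1 => mu j)]_x ((-1) ^+ r * (Dg r (thead x) * v (row_of x))).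
  by apply: eq_RintegralT => x; rewrite rowE /u mulrCA.
rewrite RintegralZl//.
(* The sign carried by [u] is cancelled by a second one. *)
have := integrableZl measurableT ((-1) ^+ r) iD.
apply: eq_integrable => // x _; rewrite /= rowE /u -EFinM; congr EFin.
by rewrite mulrCA; congr (_ * _); rewrite mulrA -expr2 sqrr_sign mul1r.
Qed.

End weak_derivative.

Theorem theorem4p9 (R : realType) (n : nat) (a b : 'I_n.+2 -> R)
    (mu : 'I_n.+2 -> {finite_measure set R -> \bar R})
    (U : 'I_n.+2 -> set R) (f : n.+2.-tuple R -> R) (alpha : R) (k : nat)
    (hab : forall j, a j <= b j)
    (hmu : forall j, mu j (~` `[a j, b j]) = 0%E)
    (hU : forall j, open (U j))
    (hmuU : forall j, mu j (`[a j, b j] `\` U j) = 0%E)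
    (hf : f \in Lfun (box_measure mu) 2%:E)
    (halpha : 2^-1 < alpha)
    (hHolder : holder_on [set x | forall j, tnth x j \in `[a j, b j]] alpha f)
    (hSob : sobolev U mu k f)
    (lambda : 'I_n.+1 -> nat -> R) (gamma : 'I_n.+2 -> nat -> R -> nat -> R)
    (hftt : is_ftt mu f lambda gamma) :
  ('N[box_measure mu]_2%:E[EFin \o (fun x => f x - ftt_sum N gamma x)%R]%E
     @[N --> \oo] --> 0%E) /\
  (forall (j : 'I_n.+2) (p q : nat),
     (j = ord0 -> p = 0%N) ->
     (j = ord_max -> q = 0%N) ->
     (forall i : 'I_n.+1, i = j :> nat -> lambda i q != 0) ->
     sobolev (fun _ : 'I_1 => U j) (fun _ : 'I_1 => mu j) k
       (fun x => gamma j p (thead x) q)).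
Proof.
have [mf _] := (Lfun2P _ f).1 hf.
split; first exact: ftt_sum_cvg mf hftt.
apply: (sobolev_core _ mu U f k lambda gamma hU _ hSob hftt) => l.
have mU := open_measurable (hU l).
have mI : measurable `[a l, b l]%classic by exact: measurable_itv.
(* The complement of [U l] is covered by the complement of the interval and the part of the interval
   outside [U l], both null. *)
apply/eqP; rewrite eq_le measure_ge0 andbT -[0%E]adde0 -{1}(hmu l) -(hmuU l).
apply: le_trans (measureU2 _ _ _); last 2 first.
- exact: measurableC.
- exact: measurableD.
apply: le_measure; rewrite ?inE.
- exact: measurableC.
- by apply: measurableU; [exact: measurableC|exact: measurableD].
by move=> x Ux; have [xI|xI] := pselect (`[a l, b l]%classic x); [right|left].
Qed.
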